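(* For every $\alpha\in[0,2]$ there exist a Hilbert space $\mathcal H$, a strongly continuous unitary group $\{U^t\}_{t\in\mathbb R}$ acting on $\mathcal H$, a vector subspace $\mathcal X\subseteq\mathcal H$ with its own norm $\|\cdot\|_{\mathcal X}$, and a constant $B>0$ such that: 1) $\|P_{t,s}-P\|_{\mathcal X\to\mathcal H}^2=B(t-s)^{-\alpha}$ for all real $t>s$; 2) for every $\varepsilon\in(0,1)$ there are $f\in\mathcal X$ and $\delta>0$ for which $$\sigma_{f-f^*}(-\delta,\delta]>\varepsilon\,\frac{\rho(\alpha)}{2^\alpha}\,B\,\|f\|_{\mathcal X}^2\,\delta^\alpha.$$
   Context: For a complex Hilbert space $\mathcal H$ with a strongly continuous unitary group $\{U^t\}_{t\in\mathbb R}$: for $f\in\mathcal H$ and real $t>s$, $P_{t,s}f=\frac1{t-s}\int_s^tU^\tau f\,d\tau$; $P$ is the orthogonal projection of $\mathcal H$ onto the subspace of vectors fixed by all $U^t$, and $f^*:=Pf$. By Stone's theorem $U^t=e^{it\mathbf B}$ with $\mathbf B$ self-adjoint; let $E$ be its spectral resolution, so that $(U^tf,g)_{\mathcal H}=\int_{\mathbb R}e^{it\lambda}\,d(E(\lambda)f,g)_{\mathcal H}$. For $h\in\mathcal H$, the spectral measure $\sigma_h$ is the finite Borel measure on $\mathbb R$ given by $\sigma_h(C)=\int_C d(E(\lambda)h,h)_{\mathcal H}$; $\sigma_h(-\delta,\delta]$ denotes $\sigma_h((-\delta,\delta])$. For an operator $T$ on $\mathcal H$, $\|T\|_{\mathcal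 X\to\mathcal H}=\sup_{f\in\mathcal X,\,f\ne0}\|Tf\|_{\mathcal H}/\|f\|_{\mathcal X}$. For $\alpha\in[0,2]$, $\rho(\alpha)=\inf_{x>0}\frac{x^{2-\alpha}}{\sin^2x}$. *)

(* Defs.v *)
From HB Require Import structures.
From mathcomp Require Import all_boot all_order all_algebra sesquilinear.
From mathcomp Require Import all_classical all_reals all_analysis.
From mathcomp Require Import complex.
Set Implicit Arguments.
Unset Strict Implicit.
Unset Printing Implicit Defensive.
Import Order.TTheory GRing.Theory Num.Theory.
Import numFieldTopology.Exports numFieldNormedType.Exports.

Local Open Scope classical_set_scope.
Local Open Scope ring_scope.
Local Open Scope complex_scope.

(* The inner product is linear in its first argument and conjugate-linear in
   its second one. *)
HB.mixin Record isHilbert (R : realType) H of CompleteNormedModule R[i] H := {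
  inner : {dot H for (@Num.conj R[i])} ;
  innerE : forall x : H, inner x x = `|x| ^+ 2 }.

#[short(type="hilbertType")]
HB.structure Definition Hilbert (R : realType) :=
  { H of isHilbert R H & CompleteNormedModule R[i] H }.

(* The library norm of a normed R[i]-module takes its values in R[i]; hnorm is
   the same number, seen in R. *)
Definition hnorm (R : realType) (H : hilbertType R) (f : H) : R :=
  complex.Re `|f|.

(* Surjectivity of each U t follows from the group law. *)
Record unitary_group (R : realType) (H : hilbertType R)
    (U : R -> {linear H -> H}) : Prop := {
  unitary_group0 : forall f, U 0 f = f ;
  unitary_groupD : forall t s f, U (t + s) f = U t (U s f) ;
  unitary_group_inner : forall t f g, inner (U t f) (U t g) = inner f g ;
  unitary_group_continuous : forall f, continuous (fun t : R => U t f) }.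

Definition fixed_vectors (R : realType) (H : hilbertType R)
    (U : R -> {linear H -> H}) : set H := [set f | forall t, U t f = f].

(* P is the orthogonal projection onto the linear subspace F. *)
Definition orthogonal_projection (R : realType) (H : hilbertType R)
    (F : set H) (P : {linear H -> H}) : Prop :=
  forall f, F (P f) /\ forall g, F g -> inner (f - P f) g = 0.

(* v is the Riemann-Stieltjes integral over [a, b] of phi with respect to the
   complex integrator G: the limit, as the mesh tends to 0, of the sums over
   partitions a = x_0 <= ... <= x_n = b with tags xi_k in [x_k, x_(k+1)]. *)
Definition is_RS_integral (R : realType) (V : normedModType R[i])
    (phi : R -> V) (G : R -> R[i]) (a b : R) (v : V) : Prop :=
  forall e : R, 0 < e -> exists2 d : R, 0 < d &
    forall (n : nat) (x xi : nat -> R), x 0%N = a -> x n = b ->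
      (forall k, (k < n)%N -> x k <= xi k <= x k.+1 /\ x k.+1 - x k < d) ->
      `|\sum_(k < n) (G (x k.+1) - G (x k)) *: phi (xi k) - v| < e%:C.

(* Riemann integral of a vector-valued function (0 if it does not exist). *)
Definition riemann_integral (R : realType) (V : normedModType R[i])
    (phi : R -> V) (a b : R) : V :=
  xget 0 [set v | is_RS_integral phi (fun x => x%:C) a b v].

Definition time_average (R : realType) (H : hilbertType R)
    (U : R -> {linear H -> H}) (t s : R) (f : H) : H :=
  ((t - s)^-1)%:C *: riemann_integral (fun tau => U tau f) s t.

(* v = int_R phi dG, as the limit of int_a^b phi dG for a --> -oo, b --> +oo *)
Definition is_RS_integral_line (R : realType) (phi G : R -> R[i]) (v : R[i]) :
    Prop :=
  exists2 I : R -> R -> R[i]^o,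
    forall a b, a < b -> is_RS_integral (phi : R -> R[i]^o) G a b (I a b) &
    I ab.1 ab.2 @[ab --> filter_prod (-oo)%R (+oo)%R] --> (v : R[i]^o).

(* Resolutions of the identity, normalized to be right-continuous, so that
   E(b) - E(a) is the spectral projection of the interval ]a, b]. *)
Record spectral_family (R : realType) (H : hilbertType R) := {
  spectral_proj :> R -> {linear H -> H} ;
  spectral_proj_selfadjoint : forall x f g,
    inner (spectral_proj x f) g = inner f (spectral_proj x g) ;
  spectral_proj_min : forall x y f,
    spectral_proj x (spectral_proj y f) = spectral_proj (Num.min x y) f ;
  spectral_proj_right_continuous : forall f (x : R),
    spectral_proj y f @[y --> x^'+] --> spectral_proj x f ;
  spectral_proj_ninfty : forall f, spectral_proj y f @[y --> -oo] --> (0 : H) ;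
  spectral_proj_pinfty : forall f, spectral_proj y f @[y --> +oo] --> f }.

Definition expi (R : realType) (x : R) : R[i] := cos x +i* sin x.

(* E is the spectral resolution of the generator B of U^t = exp(i t B): by
   Stone's theorem, it is the unique spectral family satisfying this identity. *)
Definition spectral_resolution (R : realType) (H : hilbertType R)
    (U : R -> {linear H -> H}) (E : spectral_family H) : Prop :=
  forall t f g, is_RS_integral_line (fun x => expi (t * x))
    (fun x => inner (E x f) g) (inner (U t f) g).

(* (E(x) h, h), which is a real number *)
Definition spectral_distribution (R : realType) (H : hilbertType R)
    (E : spectral_family H) (h : H) : R -> R :=
  fun x => complex.Re (inner (E x h) h).

Section spectral_distribution_cumulative.
Variables (R : realType) (H : hilbertType R) (E : spectral_family H) (h : H).

Lemma hnormE (f : H) : `|f| = (hnorm f)%:C.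
Proof.
have : `|f| \is Num.real by exact: normr_real.
by move=> /complex_realP[r]; rewrite /hnorm => ->.
Qed.

Lemma hnorm_ge0 (f : H) : 0 <= hnorm f.
Proof. by have := normr_ge0 f; rewrite hnormE ler0c. Qed.

Lemma ler_hnormB (f g : H) : `|hnorm f - hnorm g| <= hnorm (f - g).
Proof.
have hD (u v : H) : hnorm (u + v) <= hnorm u + hnorm v.
  by have := ler_normD u v; rewrite !hnormE -rmorphD /= lecR.
have hN (u : H) : hnorm (- u) = hnorm u by rewrite /hnorm normrN.
have fg := hD (f - g) g; have gf := hD (g - f) f.
rewrite !subrK in fg gf; rewrite -opprB hN in gf.
by rewrite ler_norml lerBlDr fg andbT lerNl opprB lerBlDr.
Qed.

Lemma spectral_distributionE x :
  spectral_distribution E h x = hnorm (E x h) ^+ 2.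
Proof.
rewrite /spectral_distribution -[E x h in LHS](_ : E x (E x h) = _); last first.
  by rewrite spectral_proj_min minxx.
by rewrite spectral_proj_selfadjoint innerE hnormE -rmorphXn.
Qed.

Lemma spectral_distribution_nondecreasing :
  nondecreasing (spectral_distribution E h).
Proof.
move=> x y xy; rewrite !spectral_distributionE.
have Exy : E x (E y h) = E x h by rewrite spectral_proj_min min_l.
have o : inner (E x h) (E y h - E x h) = 0.
  rewrite spectral_proj_selfadjoint linearB /= Exy spectral_proj_min minxx.
  by rewrite subrr linear0r.
have o' : inner (E y h - E x h) (E x h) = 0.
  rewrite -[X in inner _ X](_ : E x (E x h) = _); last first.
    by rewrite spectral_proj_min minxx.
  rewrite -spectral_proj_selfadjoint linearB /= Exy spectral_proj_min minxx.
  by rewrite subrr linear0l.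
have : inner (E y h) (E y h)
    = inner (E x h) (E x h) + inner (E y h - E x h) (E y h - E x h).
  have pythagoras (u v : H) : inner u v = 0 -> inner v u = 0 ->
      inner (v + u) (v + u) = inner u u + inner v v.
    by move=> uv vu; rewrite linearDl !linearDr /= uv vu addr0 add0r addrC.
  by rewrite -pythagoras// subrK.
rewrite !innerE !hnormE -!rmorphXn -rmorphD => /complexI ->.
by rewrite lerDl sqr_ge0.
Qed.

Lemma spectral_distribution_right_continuous :
  right_continuous (spectral_distribution E h).
Proof.
move=> x; rewrite (_ : spectral_distribution E h
    = fun y => hnorm (E y h) * hnorm (E y h)); last first.
  by apply/funext => y; rewrite spectral_distributionE expr2.
suff c : hnorm (E y h) @[y --> x^'+] --> hnorm (E x h) by exact: cvgM.
apply/cvgrPdist_lt => e e0.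
have /cvgrPdist_lt/(_ e%:C) := @spectral_proj_right_continuous _ _ E h x.
rewrite ltcR => /(_ e0); apply: filterS => y.
by rewrite hnormE ltcR; apply: le_lt_trans; exact: ler_hnormB.
Qed.

HB.instance Definition _ := isCumulative.Build R _ R
  (spectral_distribution E h) spectral_distribution_nondecreasing
  spectral_distribution_right_continuous.

End spectral_distribution_cumulative.

(* The Lebesgue-Stieltjes measure d(E(x) h, h) on the Borel sets of R. *)
Definition spectral_measure (R : realType) (H : hilbertType R)
    (E : spectral_family H) (h : H) : {measure set (measurableTypeR R) -> \bar R} :=
  lebesgue_stieltjes_measure (spectral_distribution E h).

(* N is a norm on the subspace X; its values outside X are irrelevant, and it
   need not be related to the norm of H. *)
Record subspace_norm (R : realType) (H : hilbertType R)
    (X : {pred H}) (N : H -> R) : Prop := {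
  subspace_norm_closed : GRing.submod_closed X ;
  subspace_norm_ge0 : {in X, forall f, 0 <= N f} ;
  subspace_norm_eq0 : {in X, forall f, N f = 0 -> f = 0} ;
  subspace_normZ : forall c : R[i],
    {in X, forall f, N (c *: f) = Normc.normc c * N f} ;
  subspace_normD : {in X &, forall f g, N (f + g) <= N f + N g} }.

Definition operator_norm (R : realType) (H : hilbertType R)
    (X : {pred H}) (N : H -> R) (T : H -> H) : \bar R :=
  ereal_sup [set (hnorm (T f) / N f)%:E | f in [set f | f \in X /\ f != 0]].

(* Points where sin x = 0 are excluded because the quotient is +oo there,
   whereas division by 0 in R returns 0. *)
Definition rho (R : realType) (alpha : R) : R :=
  inf [set x `^ (2 - alpha) / sin x ^+ 2 | x in [set x : R | 0 < x /\ sin x != 0]].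

(* Main.v *)
Require Import Defs.
From HB Require Import structures.
From mathcomp Require Import all_boot all_order all_algebra finmap sesquilinear.
From mathcomp Require Import all_classical all_reals all_analysis.
From mathcomp Require Import showcase.summability.
From mathcomp Require Import complex.
From mathcomp Require Import ring lra.
Import Order.TTheory GRing.Theory Num.Theory.
Import numFieldTopology.Exports numFieldNormedType.Exports.
Set Implicit Arguments.
Unset Strict Implicit.
Unset Printing Implicit Defensive.
Local Open Scope classical_set_scope.
Local Open Scope ring_scope.
Local Open Scope complex_scope.
Import Normc.

(** The group acts on the family space l^2 indexed by all positive reals, one
    atom at every frequency l > 0, by U^t f (l) = exp(i t l) f(l).  Only 0 is
    fixed, so P = 0, and the time average over [s, t] multiplies the l-th
    coordinate by a number of modulus |sin x| / x with x = (t - s) l / 2.  The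
    subspace X is normed by the l^2 norm of l^(-alpha/2) f(l).  The operator norm
    of a diagonal operator from this weighted space to l^2 is a supremum over the
    atoms, hence
      || P_{t,s} ||^2 = sup_l  l^alpha (sin x / x)^2
                      = (t - s)^(-alpha) 2^alpha sup_x  sin^2 x / x^(2 - alpha),
    where x runs through all positive reals because l does.  The last supremum
    is 1 / rho(alpha), so the rate holds exactly with B = 2^alpha / rho(alpha)
    (sinc_le_sharp_bound and sharp_bound_le give the two inequalities).
    With this B the second claim reads sigma_f(-d, d] > eps ||f||_X^2 d^alpha,
    and the unit vector f concentrated at the frequency d satisfies
    sigma_f(-d, d] = 1 = ||f||_X^2 d^alpha (delta_spectral_measure,
    weighted_delta).

    Most of the work is to build the Hilbert space and to compute on it.  Sums over
    the uncountable index set are limits along finite subsets; polarization reduces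
    the inner product to sums of squares.  All analytic facts about the group (its
    strong continuity, the limits of its spectral family, the value of its time
    averages) follow from one tool, dominated convergence in l^2
    (ell2_dominated_cvg), since every vector involved is dominated coordinatewise
    by a fixed one.  The spectral integral is computed with hnorm_dom: each
    Riemann-Stieltjes sum is diagonal, and its entries differ from those of U^t, cut
    off to the interval of integration, by at most |t| times the mesh. *)

#[local] Existing Instance totally_filter.

(** * Complex numbers *)

Section complex_facts.
Variable R : realType.
Implicit Types (z w : R[i]) (e : R[i]).

Lemma normcR z : `|z| = (normc z)%:C. Proof. by rewrite normc_def; case: z. Qed.

Lemma normc_ge0 z : 0 <= normc z. Proof. by rewrite -ler0c -normcR. Qed.

Lemma sqr_normcE z : normc z ^+ 2 = complex.Re z ^+ 2 + complex.Im z ^+ 2.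
Proof. by apply: complexI; rewrite add_Re2_Im2 normcR -rmorphXn. Qed.

Lemma normc_real (x : R) : normc x%:C = `|x|.
Proof. by rewrite /= expr0n addr0 sqrtr_sqr. Qed.

Lemma normc_sum (J : Type) (s : seq J) (F : J -> R[i]) :
  normc (\sum_(j <- s) F j) <= \sum_(j <- s) normc (F j).
Proof.
by rewrite -lecR rmorph_sum /= -normcR; exact: ler_norm_sum.
Qed.

Lemma normcB z w : normc (z - w) <= normc z + normc w.
Proof. by rewrite -(normcN w) le_normcD. Qed.

Lemma normc_dist z w : `|normc z - normc w| <= normc (z - w).
Proof.
have h1 := le_normcD (z - w) w; have h2 := le_normcD (w - z) z.
rewrite !subrK in h1 h2; rewrite -opprB normcN in h2.
by rewrite ler_norml lerBlDr h1 andbT lerNl opprB lerBlDr.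
Qed.

Lemma gt0_complexE e : 0 < e -> 0 < complex.Re e /\ e = (complex.Re e)%:C.
Proof. by case: e => a b; rewrite ltcE /= => /andP[/eqP -> ->]. Qed.

Lemma cvg_complexP (T : Type) (F : set_system T) (FF : Filter F)
    (u : T -> R[i]^o) (z : R[i]^o) :
  (u @ F --> z) <-> forall e : R, 0 < e -> \forall y \near F, normc (z - u y) < e.
Proof.
split=> [/cvgrPdist_lt h e e0|h].
  have := h e%:C; rewrite ltcR => /(_ e0); apply: filterS => y.
  by rewrite normcR ltcR.
apply/cvgrPdist_lt => e /gt0_complexE[e0 ->]; apply: filterS (h _ e0) => y.
by rewrite normcR ltcR.
Qed.

Lemma normc_ReIm z : normc z <= `|complex.Re z| + `|complex.Im z|.
Proof.
rewrite -ler_sqr ?nnegrE ?addr_ge0 ?normc_ge0// sqr_normcE sqrrD.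
by rewrite !real_normK ?num_real// addrAC lerDl mulrn_wge0 ?mulr_ge0.
Qed.

Lemma le_Re_normc z : `|complex.Re z| <= normc z.
Proof.
rewrite -[leLHS]ger0_norm // -ler_sqr ?nnegrE ?normc_ge0 //.
by rewrite normr_id sqr_normcE real_normK ?num_real// lerDl sqr_ge0.
Qed.

Lemma le_Im_normc z : `|complex.Im z| <= normc z.
Proof.
rewrite -[leLHS]ger0_norm // -ler_sqr ?nnegrE ?normc_ge0 //.
by rewrite normr_id sqr_normcE real_normK ?num_real// lerDr sqr_ge0.
Qed.

Lemma cvg_ReIm (T : Type) (F : set_system T) (FF : Filter F)
    (u : T -> R[i]^o) (a b : R) :
  complex.Re (u y) @[y --> F] --> a -> complex.Im (u y) @[y --> F] --> b ->
  u @ F --> (a +i* b : R[i]^o).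
Proof.
move=> /cvgrPdist_lt ua /cvgrPdist_lt ub; apply/cvg_complexP => e e0.
have e2 : 0 < e / 2 by rewrite divr_gt0.
near=> y; apply: le_lt_trans (normc_ReIm _) _; rewrite [e]splitr.
case: (u y) (near (ua _ e2) y) (near (ub _ e2) y) => c d /= h1 h2.
by rewrite ltrD// ?h1 ?h2.
Unshelve. all: by end_near. Qed.

Lemma complex_cauchy_cvg (F : set_system R[i]^o) :
  ProperFilter F -> cauchy F -> cvg F.
Proof.
move=> PF /cauchyP cF.
have cauchy_comp (p : R[i]^o -> R) :
    (forall z w, `|p z - p w| <= normc (z - w)) -> cvg (p @ F).
  move=> pl; apply: R_complete; apply/cauchyP => e e0.
  have [|z Fz] := cF e%:C; first by rewrite ltcR.
  exists (p z); change (F (p @^-1` ball (p z) e)).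
  apply: filterS Fz => w /=; rewrite -!ball_normE /ball_/= => zw.
  have {zw} : `|(z - w : R[i])| < e%:C by [].
  by rewrite normcR ltcR; exact: le_lt_trans.
have /cvg_ex[/= a Fa] : cvg ((@complex.Re R : R[i]^o -> R) @ F).
  apply: cauchy_comp => z w; apply: le_trans (le_Re_normc _).
  by case: z => ? ?; case: w.
have /cvg_ex[/= b Fb] : cvg ((@complex.Im R : R[i]^o -> R) @ F).
  apply: cauchy_comp => z w; apply: le_trans (le_Im_normc _).
  by case: z => ? ?; case: w.
by apply/cvg_ex; exists (a +i* b : R[i]^o); exact: cvg_ReIm Fa Fb.
Qed.

End complex_facts.

(** * Sums over arbitrary index sets *)

Section unconditional_sums.
Variables (R : realType) (I : choiceType).
Implicit Types (r : I -> R) (f g : I -> R[i]) (A B : {fset I}).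

Lemma partial_sumE (V : zmodType) (x : I -> V) A :
  partial_sum x A = \sum_(i <- A) x i.
Proof. by rewrite /partial_sum big_seq_fsetE. Qed.

Lemma near_totally A : \forall B \near totally, (A `<=` B)%fset.
Proof. by exists A. Qed.

Lemma le_partial_sum r A B : (forall i, 0 <= r i) -> (A `<=` B)%fset ->
  \sum_(i <- A) r i <= \sum_(i <- B) r i.
Proof.
move=> r0 AB; rewrite [leRHS](big_fsetID _ [in A])/=.
rewrite (_ : [fset x in B | x \in A] = A)%fset; last first.
  apply/fsetP => i; rewrite !inE /=; case: (boolP (i \in A)) => iA.
    by rewrite (fsubsetP AB).
  by rewrite andbF.
by rewrite lerDl sumr_ge0.
Qed.

Lemma nonneg_partial_sum_cvg r M : (forall i, 0 <= r i) ->
  (forall A, \sum_(i <- A) r i <= M) -> cvg (partial_sum r @ totally).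
Proof.
move=> r0 rM; pose S := [set \sum_(i <- A) r i | A in [set: {fset I}]].
have supS : has_sup S.
  split; first by exists (\sum_(i <- fset0%fset) r i); exists fset0%fset.
  by exists M => _ [A _ <-].
apply/cvg_ex; exists (sup S); apply/cvgrPdist_lt => e e0.
have [_ [A _ <-] hA] := sup_adherent e0 supS.
apply: filterS (near_totally A) => B AB; rewrite partial_sumE.
have hB : \sum_(i <- B) r i <= sup S by apply: (sup_upper_bound supS); exists B.
rewrite ger0_norm ?subr_ge0// ltrBlDl -ltrBlDr.
exact: lt_le_trans hA (le_partial_sum r0 AB).
Qed.

Lemma partial_sum_le_lim r A : (forall i, 0 <= r i) ->
  cvg (partial_sum r @ totally) -> \sum_(i <- A) r i <= summability.sum r.
Proof.
move=> r0 cr; apply: limr_ge => //.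
by apply: filterS (near_totally A) => B AB; rewrite partial_sumE le_partial_sum.
Qed.

Definition sq_bounded (M : R) f := forall A, \sum_(i <- A) normc (f i) ^+ 2 <= M.

Definition sq_summable : {pred I -> R[i]} :=
  fun f => `[< exists M, sq_bounded M f >].

Lemma sq_summableP f : reflect (exists M, sq_bounded M f) (f \in sq_summable).
Proof. exact: asboolP. Qed.

Lemma sq_summable_dom (c : R) f g : (forall i, normc (f i) <= c * normc (g i)) ->
  g \in sq_summable -> f \in sq_summable.
Proof.
move=> fg /sq_summableP[M gM]; apply/sq_summableP; exists (c ^+ 2 * M) => A.
apply: (@le_trans _ _ (c ^+ 2 * \sum_(i <- A) normc (g i) ^+ 2)).
  rewrite mulr_sumr ler_sum// => i _; rewrite -exprMn ler_sqr// nnegrE.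
    exact: normc_ge0.
  by apply: le_trans (fg i); exact: normc_ge0.
by rewrite ler_wpM2l ?sqr_ge0.
Qed.

Lemma sq_summable_submod : submod_closed sq_summable.
Proof.
split.
  apply/sq_summableP; exists 0 => A; rewrite big1// => i _.
  by rewrite normc0 expr0n.
move=> c f g /(@sq_summable_dom (normc c) (c *: f))-/(_ _)/sq_summableP[].
  by move=> i; rewrite normcM.
move=> M fM /sq_summableP[N gN]; apply/sq_summableP.
exists (2 * M + 2 * N) => A.
apply: le_trans (lerD (ler_wpM2l _ (fM A)) (ler_wpM2l _ (gN A))) => //.
rewrite !mulr_sumr -big_split ler_sum//= => i _.
set a := (c *: f) i; set b := g i.
rewrite (_ : (c *: f + g) i = a + b)//.
apply: (@le_trans _ _ ((normc a + normc b) ^+ 2)).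
  by rewrite ler_sqr ?nnegrE ?addr_ge0 ?normc_ge0 ?le_normcD.
by have := sqr_ge0 (normc a - normc b); nra.
Qed.

(** Polarization reduces the series to sums of squares of moduli. *)
Lemma sq_summable_mulJ_cvg f g : f \in sq_summable -> g \in sq_summable ->
  cvg (partial_sum (fun i => f i * (g i)^* : R[i]^o) @ totally).
Proof.
have sqP h : h \in sq_summable ->
    exists l : R, partial_sum (fun i => normc (h i) ^+ 2) @ totally --> l.
  move=> /sq_summableP[M hM]; apply/cvg_ex/(@nonneg_partial_sum_cvg _ M) => // i.
  exact: sqr_ge0.
move=> fl gl; have [sZ0 sZD] := sq_summable_submod.
have fgl : f + g \in sq_summable by rewrite -(scale1r f) sZD.
have figl : f + 'i *: g \in sq_summable by rewrite addrC sZD.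
have [[a fa] [b gb]] := (sqP _ fl, sqP _ gl).
have [[c fgc] [d figd]] := (sqP _ fgl, sqP _ figl).
apply/cvg_ex.
exists (((c - a - b) / 2) +i* ((d - a - b) / 2) : R[i]^o).
have sumRe (x : I -> R[i]^o) A :
    complex.Re (partial_sum x A) = partial_sum (fun i => complex.Re (x i)) A.
  by rewrite !partial_sumE; elim/big_ind2 : _ => // y1 [? ?] y2 [? ?] <- <-.
have sumIm (x : I -> R[i]^o) A :
    complex.Im (partial_sum x A) = partial_sum (fun i => complex.Im (x i)) A.
  by rewrite !partial_sumE; elim/big_ind2 : _ => // y1 [? ?] y2 [? ?] <- <-.
apply: cvg_ReIm.
  under eq_fun do rewrite sumRe.
  rewrite (_ : (fun A => _) = fun A =>
    (partial_sum (fun i => normc ((f + g) i) ^+ 2) A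
    - partial_sum (fun i => normc (f i) ^+ 2) A
    - partial_sum (fun i => normc (g i) ^+ 2) A) * 2^-1).
    by apply: cvgMl; apply: cvgB => //; exact: cvgB.
  apply/funext => A; rewrite !partial_sumE -!sumrB mulr_suml.
  apply: eq_bigr => i _; rewrite (_ : (f + g) i = f i + g i)// !sqr_normcE.
  by case: (f i) => p q; case: (g i) => u v /=; field.
under eq_fun do rewrite sumIm.
rewrite (_ : (fun A => _) = fun A =>
  (partial_sum (fun i => normc ((f + 'i *: g) i) ^+ 2) A
  - partial_sum (fun i => normc (f i) ^+ 2) A
  - partial_sum (fun i => normc (g i) ^+ 2) A) * 2^-1).
  by apply: cvgMl; apply: cvgB => //; exact: cvgB.
apply/funext => A; rewrite !partial_sumE -!sumrB mulr_suml.
apply: eq_bigr => i _; rewrite (_ : (f + 'i *: g) i = f i + 'i * g i)// !sqr_normcE.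
by case: (f i) => p q; case: (g i) => u v /=; field.
Qed.

End unconditional_sums.

(** * Square-summable families *)

HB.instance Definition _ (R : realType) (I : choiceType) :=
  GRing.isSubmodClosed.Build R[i] (I -> R[i]) (@sq_summable R I)
    (@sq_summable_submod R I).

Record ell2 (R : realType) (I : choiceType) := Ell2 {
  ell2_val :> I -> R[i] ;
  ell2_sq_summable : ell2_val \in @sq_summable R I }.

HB.instance Definition _ R I := [isSub for @ell2_val R I].
HB.instance Definition _ R I := [Choice of ell2 R I by <:].
HB.instance Definition _ R I := [SubChoice_isSubLmodule of ell2 R I by <:].

Section ell2_inner.
Variables (R : realType) (I : choiceType).
Implicit Types (f g h : ell2 R I) (A B : {fset I}).

Lemma ell2P f g : (forall i, f i = g i) -> f = g.
Proof. by move=> fg; apply/val_inj/funext. Qed.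

Lemma ell2DE f g i : (f + g) i = f i + g i. Proof. by []. Qed.
Lemma ell2NE f i : (- f) i = - f i. Proof. by []. Qed.
Lemma ell2ZE c f i : (c *: f) i = c * f i. Proof. by []. Qed.
Lemma ell20E i : (0 : ell2 R I) i = 0. Proof. by []. Qed.

Lemma ell2_sumE (J : Type) (s : seq J) (F : J -> ell2 R I) i :
  (\sum_(j <- s) F j) i = \sum_(j <- s) F j i.
Proof. by elim/big_ind2 : _ => // x f y g <- <-. Qed.

Definition ell2_inner f g : R[i] :=
  summability.sum (fun i => f i * (g i)^* : R[i]^o).

Definition ell2_sqnorm f : R := summability.sum (fun i => normc (f i) ^+ 2).

Lemma ell2_inner_cvg f g :
  partial_sum (fun i => f i * (g i)^* : R[i]^o) @ totally
    --> (ell2_inner f g : R[i]^o).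
Proof. by apply: sq_summable_mulJ_cvg; exact: ell2_sq_summable. Qed.

Lemma ell2_innerP f g (z : R[i]^o) :
  partial_sum (fun i => f i * (g i)^* : R[i]^o) @ totally --> z ->
  ell2_inner f g = z.
Proof. by move=> fgz; apply: (cvg_lim _ fgz); exact: norm_hausdorff. Qed.

Lemma ell2_sqnorm_cvg f :
  partial_sum (fun i => normc (f i) ^+ 2) @ totally --> ell2_sqnorm f.
Proof.
have /sq_summableP[M fM] := ell2_sq_summable f.
by apply: (@nonneg_partial_sum_cvg _ _ _ M) => // i; exact: sqr_ge0.
Qed.

Lemma ell2_inner_linearl h a : forall f g,
  ell2_inner (a *: f + g) h = a * ell2_inner f h + ell2_inner g h.
Proof.
move=> f g; apply: ell2_innerP.
rewrite (_ : partial_sum _ = fun A =>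
    a *: partial_sum (fun i => f i * (h i)^* : R[i]^o) A
    + partial_sum (fun i => g i * (h i)^* : R[i]^o) A).
  by apply: cvgD; [apply: cvgZr|]; exact: ell2_inner_cvg.
apply/funext => A; rewrite !partial_sumE scaler_sumr -big_split /=.
by apply: eq_bigr => i _; rewrite [LHS]mulrDl -mulrA.
Qed.

Lemma conjE (z : R[i]) : Num.conj z = z^*.
Proof. by []. Qed.

Lemma normc_conj (z : R[i]) : normc z^* = normc z.
Proof. by case: z => a b /=; rewrite sqrrN. Qed.

Lemma ell2_inner_sym f g : ell2_inner f g = (ell2_inner g f)^*.
Proof.
apply: ell2_innerP; apply/cvg_complexP => e e0.
have /cvg_complexP/(_ e e0) := @ell2_inner_cvg g f.
apply: filterS => A; rewrite -normc_conj; congr (normc _ < _).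
rewrite rmorphB; congr (_ - _); rewrite !partial_sumE rmorph_sum /=.
by apply: eq_bigr => i _; rewrite rmorphM /= conjcK mulrC.
Qed.

Lemma ell2_inner_sqnorm f : ell2_inner f f = (ell2_sqnorm f)%:C.
Proof.
apply: ell2_innerP; apply/cvg_complexP => e e0.
have /cvgrPdist_lt/(_ e e0) := @ell2_sqnorm_cvg f.
apply: filterS => A; rewrite -normc_real rmorphB; congr (normc (_ - _) < _).
rewrite !partial_sumE rmorph_sum /=.
by apply: eq_bigr => i _; rewrite -sqr_normc normcR rmorphXn.
Qed.

Lemma partial_sum_le_sqnorm f A : \sum_(i <- A) normc (f i) ^+ 2 <= ell2_sqnorm f.
Proof.
apply: partial_sum_le_lim; first by move=> i; exact: sqr_ge0.
by apply/cvg_ex; exists (ell2_sqnorm f); exact: ell2_sqnorm_cvg.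
Qed.

Lemma sqnorm_le f M : sq_bounded M f -> ell2_sqnorm f <= M.
Proof.
move=> fM; apply: limr_le; last first.
  by apply: nearW => A; rewrite partial_sumE; exact: fM.
by apply/cvg_ex; exists (ell2_sqnorm f); exact: ell2_sqnorm_cvg.
Qed.

Lemma coord_le_sqnorm f i : normc (f i) ^+ 2 <= ell2_sqnorm f.
Proof. by have := partial_sum_le_sqnorm f [fset i]%fset; rewrite big_seq_fset1. Qed.

Lemma ell2_inner_bilinear :
  bilinear_for (GRing.Scale.Law.clone R[i] R[i] *%R _)
    (GRing.Scale.Law.clone R[i] R[i] (Num.conj \; *%R) _) ell2_inner.
Proof.
split=> [g c f1 f2|f c g1 g2] /=; first exact: ell2_inner_linearl.
rewrite ell2_inner_sym ell2_inner_linearl rmorphD rmorphM /=.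
by rewrite -!ell2_inner_sym.
Qed.

HB.instance Definition _ := bilinear_isBilinear.Build R[i] (ell2 R I) (ell2 R I)
  R[i] _ _ ell2_inner ell2_inner_bilinear.

Lemma ell2_inner_herm f g : ell2_inner f g = (-1) ^+ false * Num.conj (ell2_inner g f).
Proof. by rewrite expr0 mul1r ell2_inner_sym. Qed.

HB.instance Definition _ := isHermitianSesquilinear.Build R[i] (ell2 R I) false
  (@Num.conj R[i]) ell2_inner ell2_inner_herm.

Lemma ell2_inner_gt0 f : f != 0 -> 0 < ell2_inner f f.
Proof.
move=> f0; rewrite ell2_inner_sqnorm ltcR lt_def; apply/andP; split; last first.
  by apply: le_trans (partial_sum_le_sqnorm f fset0); rewrite big_seq_fset0.
apply: contra f0 => /eqP f0; apply/eqP/ell2P => i; apply: eq0_normc.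
apply/eqP; rewrite -sqrf_eq0 eq_le sqr_ge0 andbT -f0; exact: coord_le_sqnorm.
Qed.

HB.instance Definition _ := isDotProduct.Build R[i] (ell2 R I) ell2_inner
  ell2_inner_gt0.

End ell2_inner.

(** * The l^2 norm and completeness *)

Lemma cvg_sum_seq (R : realType) (T J : Type) (F : set_system T) (s : seq J)
    (u : J -> T -> R) (l : J -> R) : Filter F ->
  (forall j, u j @ F --> l j) ->
  \sum_(j <- s) u j y @[y --> F] --> \sum_(j <- s) l j.
Proof.
move=> FF ul; elim: s => [|j s IHs].
  by under eq_fun do rewrite big_nil; rewrite big_nil; exact: cvg_cst.
by under eq_fun do rewrite big_cons; rewrite big_cons; exact: cvgD.
Qed.

Section cauchy_schwarz.
Variables (C : numClosedFieldType) (U : lmodType C) (dot : {dot U for (@Num.conj C)}).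

Lemma dot_conj u v : dot u v = Num.conj (dot v u).
Proof. by rewrite hermC expr0 mul1r. Qed.

(** Expand the form at dot v v *: u - dot u v *: v, which avoids a division. *)
Lemma dot_CauchySchwarz u v : `|dot u v| ^+ 2 <= dot u u * dot v v.
Proof.
have [->|v0] := eqVneq v 0.
  by rewrite [dot u 0]linear0r [dot 0 0]linear0r normr0 expr0n mulr0.
have vv : 0 < dot v v by rewrite dnorm_gt0.
have := dnorm_ge0 dot (dot v v *: u - dot u v *: v).
rewrite linearBl !linearBr /= !linearZl_LR !linearZr_LR /=.
rewrite -(dot_conj v v) -(dot_conj v u) normCK -(dot_conj v u).
set uu := dot u u; set uv := dot u v; set vu := dot v u; set w := dot v v => H.
rewrite -subr_ge0 -(pmulr_rge0 _ vv) -/w.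
by rewrite (_ : w * _ =
  w * (w * uu) - vu * (w * uv) - (w * (uv * vu) - vu * (uv * w)))//; ring.
Qed.

End cauchy_schwarz.

Section ell2_norm.
Variables (R : realType) (I : choiceType).
Implicit Types (f g h : ell2 R I) (A B : {fset I}).

Lemma ell2_sqnorm_ge0 f : 0 <= ell2_sqnorm f.
Proof. by have := partial_sum_le_sqnorm f fset0; rewrite big_seq_fset0. Qed.

Definition ell2_norm f : R := Num.sqrt (ell2_sqnorm f).

Lemma ell2_inner_norm f : ell2_inner f f = (ell2_norm f ^+ 2)%:C.
Proof. by rewrite ell2_inner_sqnorm sqr_sqrtr// ell2_sqnorm_ge0. Qed.

Lemma normc_inner_le f g : normc (ell2_inner f g) <= ell2_norm f * ell2_norm g.
Proof.
rewrite -ler_sqr ?nnegrE ?normc_ge0 ?mulr_ge0 ?sqrtr_ge0// -lecR.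
rewrite rmorphXn /= -normcR exprMn rmorphM /= -!ell2_inner_norm.
exact: (dot_CauchySchwarz (@ell2_inner R I)).
Qed.

Lemma ell2_normD f g : ell2_norm (f + g) <= ell2_norm f + ell2_norm g.
Proof.
rewrite -ler_sqr ?nnegrE ?addr_ge0 ?sqrtr_ge0// -lecR -ell2_inner_norm.
rewrite [ell2_inner _ _]dnormD /= !ell2_inner_norm.
rewrite (_ : (ell2_norm f + ell2_norm g) ^+ 2 = ell2_norm f ^+ 2
  + ell2_norm g ^+ 2 + 2 * (ell2_norm f * ell2_norm g)); last by ring.
rewrite rmorphD [X in _ <= X + _]rmorphD /= lerD2l.
rewrite conjE addcJ -(rmorph_nat (real_complex R)) -rmorphM lecR ler_pM2l//.
apply: le_trans (normc_inner_le f g); apply: le_trans (le_Re_normc _).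
exact: ler_norm.
Qed.

Lemma ell2_normZ c f : ell2_norm (c *: f) = normc c * ell2_norm f.
Proof.
apply/eqP; rewrite -(@eqrXn2 _ 2) ?mulr_ge0 ?normc_ge0 ?sqrtr_ge0//.
rewrite -(inj_eq (@complexI R)) -ell2_inner_norm [ell2_inner _ _]dnormZ /=.
by rewrite ell2_inner_norm normcR -rmorphXn -rmorphM /= exprMn.
Qed.

Lemma ell2_norm_eq0 f : ell2_norm f = 0 -> f = 0.
Proof.
move=> f0; have [//|/ell2_inner_gt0] := eqVneq f 0.
by rewrite ell2_inner_norm f0 expr0n ltxx.
Qed.

Let normC f : R[i] := (ell2_norm f)%:C.

Let normCD f g : normC (f + g) <= normC f + normC g.
Proof. by rewrite -rmorphD lecR ell2_normD. Qed.

Let normCZ c f : normC (c *: f) = `|c| * normC f.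
Proof. by rewrite /normC ell2_normZ normcR rmorphM. Qed.

Let normC_eq0 f : normC f = 0 -> f = 0.
Proof. by move=> [/ell2_norm_eq0]. Qed.

HB.instance Definition _ := Lmodule_isNormed.Build R[i] (ell2 R I)
  normCD normCZ normC_eq0.

End ell2_norm.

Lemma ell2_normE (R : realType) (I : choiceType) (f : ell2 R I) :
  `|f| = (ell2_norm f)%:C.
Proof. by []. Qed.

Section ell2_complete.
Variables (R : realType) (I : choiceType).
Implicit Types (f g h : ell2 R I) (A B : {fset I}).

Lemma coord_le_norm f i : normc (f i) <= ell2_norm f.
Proof.
rewrite -ler_sqr ?nnegrE ?normc_ge0 ?sqrtr_ge0// sqr_sqrtr ?ell2_sqnorm_ge0//.
exact: coord_le_sqnorm.
Qed.

Lemma ell2_norm_le f M : 0 <= M -> sq_bounded (M ^+ 2) f -> ell2_norm f <= M.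
Proof.
move=> M0 fM; rewrite -ler_sqr ?nnegrE ?sqrtr_ge0//.
by rewrite sqr_sqrtr ?ell2_sqnorm_ge0 ?sqnorm_le.
Qed.

Lemma partial_sum_le_norm f A :
  \sum_(i <- A) normc (f i) ^+ 2 <= ell2_norm f ^+ 2.
Proof. by rewrite sqr_sqrtr ?ell2_sqnorm_ge0// partial_sum_le_sqnorm. Qed.

(** The coordinates of a Cauchy filter converge.  The bounds on the finite partial
    sums pass to the limit, so the coordinatewise limit is square-summable and is
    the limit in norm. *)
Lemma ell2_complete (F : set_system (ell2 R I)) :
  ProperFilter F -> cauchy F -> cvg F.
Proof.
move=> PF /cauchyP cF.
have cF' e : 0 < e -> exists f, F [set g | ell2_norm (f - g) < e].
  move=> e0; have [|f Ff] := cF e%:C; first by rewrite ltcR.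
  exists f; apply: filterS Ff => g; rewrite -ball_normE /ball_/=.
  by rewrite ell2_normE ltcR.
have cvg_coord i : exists z : R[i]^o, (fun f : ell2 R I => f i : R[i]^o) @ F --> z.
  apply/cvg_ex; apply: complex_cauchy_cvg; apply/cauchyP => e /gt0_complexE[e0 ->].
  have [f Ff] := cF' _ e0; exists (f i).
  change (F ((fun g : ell2 R I => g i : R[i]^o)
    @^-1` ball (f i : R[i]^o) (complex.Re e)%:C)).
  apply: filterS Ff => g /= fg; rewrite -ball_normE /ball_/=.
  have -> : (f i : R[i]^o) - g i = (f - g) i by [].
  by rewrite [X in X < _]normcR ltcR; apply: le_lt_trans fg; exact: coord_le_norm.
have [l Fl] := choice cvg_coord.
have bound e f : F [set g | ell2_norm (f - g) < e] ->
    sq_bounded (e ^+ 2) (fun i => f i - l i).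
  move=> Ff A.
  have cA : (fun g : ell2 R I => \sum_(i <- A) normc (f i - g i) ^+ 2) @ F
      --> \sum_(i <- A) normc (f i - l i) ^+ 2.
    apply: cvg_sum_seq => i; under eq_fun do rewrite expr2.
    rewrite expr2; suff c : normc (f i - g i) @[g --> F] --> normc (f i - l i).
      exact: cvgM.
    apply/cvgrPdist_lt => e' e'0.
    have /cvg_complexP/(_ e' e'0) := Fl i; apply: filterS => g; apply: le_lt_trans.
    apply: le_trans (normc_dist _ _) _; rewrite -normcN.
    by rewrite opprB opprB addrC addrA subrK.
  apply: (closed_cvg _ (@closed_le R (e ^+ 2)) _ _ cA).
  apply: filterS Ff => g /= fg.
  apply: le_trans (partial_sum_le_norm (f - g) A) _.
  by rewrite ler_sqr ?nnegrE ?sqrtr_ge0 ?ltW// (le_lt_trans _ fg)// sqrtr_ge0.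
have lP : l \in @sq_summable R I.
  have [f Ff] := cF' 1 ltr01; have [_ clos] := @sq_summable_submod R I.
  have fl : (fun i => f i - l i) \in @sq_summable R I.
    by apply/sq_summableP; exists (1 ^+ 2); exact: bound.
  rewrite (_ : l = -1 *: (fun i => f i - l i) + f) ?clos ?ell2_sq_summable//.
  by apply/funext => i /=; rewrite scaleN1r [RHS]addrC opprB addrCA subrr addr0.
apply/cvg_ex; exists (Ell2 lP); apply/cvgrPdist_lt => e /gt0_complexE[e0 ->].
have e2 : 0 < complex.Re e / 2 by rewrite divr_gt0.
have [f Ff] := cF' _ e2; apply: filterS (Ff) => g /= fg.
rewrite ell2_normE ltcR (_ : Ell2 lP - g = (f - g) - (f - Ell2 lP)); last first.
  by rewrite opprB [RHS]addrC addrA subrK.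
apply: le_lt_trans (ell2_normD _ _) _; rewrite [ltRHS]splitr ltr_leD//.
rewrite -scaleN1r ell2_normZ normcN [normc _]normc1 mul1r.
by apply: ell2_norm_le; [exact: ltW|exact: bound].
Qed.

HB.instance Definition _ := Uniform_isComplete.Build (ell2 R I) ell2_complete.

Let ell2_innerE f : ell2_inner f f = `|f| ^+ 2.
Proof. by rewrite ell2_inner_norm ell2_normE rmorphXn. Qed.

HB.instance Definition _ := isHilbert.Build R (ell2 R I) ell2_innerE.

End ell2_complete.

(** * Estimates on the unit circle *)

Section unit_circle.
Variable R : realType.
Implicit Types a b x : R.

Lemma expi0 : expi 0 = 1 :> R[i].
Proof. by rewrite /expi cos0 sin0. Qed.

Lemma expiD a b : expi (a + b) = expi a * expi b.
Proof. by rewrite /expi cosD sinD; congr (_ +i* _); rewrite addrC. Qed.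

Lemma normc_expi a : normc (expi a) = 1.
Proof. by rewrite /= cos2Dsin2 sqrtr1. Qed.

Lemma sin_mvt a b : a <= b ->
  exists2 c, c \in `[a, b] & sin b - sin a = cos c * (b - a).
Proof.
move=> ab; apply: MVT_segment => //.
by apply: continuous_subspaceT => x; exact: continuous_sin.
Qed.

Lemma cos_mvt a b : a <= b ->
  exists2 c, c \in `[a, b] & cos b - cos a = - sin c * (b - a).
Proof.
move=> ab; apply: (@MVT_segment R cos (fun c => - sin c)) => //.
by apply: continuous_subspaceT => x; exact: continuous_cos.
Qed.

Lemma sin_norm_le x : `|sin x| <= `|x|.
Proof.
wlog x0 : x / 0 <= x.
  move=> h; have [/h//|x0] := leP 0 x.
  by rewrite -normrN -sinN -(normrN x) h// oppr_ge0 ltW.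
have [c _] := sin_mvt x0; rewrite sin0 !subr0 => ->.
by rewrite normrM ler_piMl// cos_max.
Qed.

(** The half-angle formula; it produces the sine that occurs in rho. *)
Lemma expi_chord a b : normc (expi a - expi b) = 2 * `|sin ((a - b) / 2)|.
Proof.
apply/eqP; rewrite -(@eqrXn2 _ 2) ?mulr_ge0 ?normc_ge0//.
rewrite sqr_normcE exprMn real_normK ?num_real//=; apply/eqP.
set h := (a - b) / 2; have abh : a - b = h *+ 2 by rewrite -mulr_natr divfK.
have := cos_mulr2n h; rewrite -abh cosB mulr2n.
have := cos2Dsin2 a; have := cos2Dsin2 b; have := cos2Dsin2 h.
set ca := cos a; set cb := cos b; set sa := sin a; set sb := sin b.
set s := sin _; set c := cos _ => h1 h2 h3 hc.
rewrite (_ : _ + _ = (ca ^+ 2 + sa ^+ 2) + (cb ^+ 2 + sb ^+ 2)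
  - 2 * (ca * cb + sa * sb)); last by ring.
rewrite h3 h2 hc; have -> : c ^+ 2 = 1 - s ^+ 2 by rewrite -h1 addrK.
by ring.
Qed.

Lemma expi_lipschitz a b : normc (expi a - expi b) <= `|a - b|.
Proof.
rewrite expi_chord; apply: le_trans (ler_wpM2l _ (sin_norm_le _)) _ => //.
by rewrite normrM (ger0_norm (_ : 0 <= 2^-1)) ?invr_ge0// mulrCA mulfV// mulr1.
Qed.

(** The derivative is taken at an arbitrary point c, because the tags of Riemann
    sums are arbitrary; the mean value theorem is applied to sin and cos separately,
    which costs the factor 2. *)
Lemma expi_increment a b c : a <= c <= b ->
  normc ((b - a)%:C * ('i * expi c) - (expi b - expi a)) <= 2 * (b - a) ^+ 2.
Proof.
move=> /andP[ac cb]; have ab := le_trans ac cb.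
have [u /[!in_itv]/=/andP[au ub] su] := sin_mvt ab.
have [v /[!in_itv]/=/andP[av vb] cv] := cos_mvt ab.
have uc : `|c - u| <= b - a by rewrite ler_norml; apply/andP; split; lra.
have vc : `|c - v| <= b - a by rewrite ler_norml; apply/andP; split; lra.
have hu : `|cos c - cos u| <= b - a.
  exact: le_trans (le_trans (le_Re_normc (expi c - expi u)) (expi_lipschitz _ _)) uc.
have hv : `|sin c - sin v| <= b - a.
  exact: le_trans (le_trans (le_Im_normc (expi c - expi v)) (expi_lipschitz _ _)) vc.
apply: le_trans (normc_ReIm ((b - a)%:C * (('i : R[i]) * expi c)
  - (expi b - expi a))) _ => /=.
rewrite su cv !(mul0r, mulr0, mul1r, subr0, sub0r, addr0, add0r).
rewrite (_ : _ - - sin v * _ = (b - a) * - (sin c - sin v)); last by ring.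
rewrite (_ : _ - cos u * _ = (b - a) * (cos c - cos u)); last by ring.
rewrite !normrM normrN (ger0_norm (_ : 0 <= b - a)) ?subr_ge0//.
by rewrite mulr_natl mulr2n expr2 lerD// ler_wpM2l ?subr_ge0.
Qed.

End unit_circle.

(** * Dominated convergence and diagonal operators *)

Section dominated_convergence.
Variables (R : realType) (I : choiceType).
Implicit Types (f g h : ell2 R I) (A B : {fset I}).

(** The norm estimates for diagonal operators below are all instances of this
    comparison. *)
Lemma hnorm_dom (c : R) f g : 0 <= c ->
  (forall i, normc (f i) <= c * normc (g i)) -> hnorm f <= c * hnorm g.
Proof.
move=> c0 fg; apply: ell2_norm_le => [|A].
  by rewrite mulr_ge0// hnorm_ge0.
rewrite exprMn; apply: le_trans (ler_wpM2l _ (partial_sum_le_norm g A)); last first.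
  exact: sqr_ge0.
rewrite mulr_sumr ler_sum// => i _; rewrite -exprMn ler_sqr// nnegrE ?normc_ge0//.
by rewrite mulr_ge0// normc_ge0.
Qed.

Lemma hnorm_le f g : (forall i, normc (f i) <= normc (g i)) -> hnorm f <= hnorm g.
Proof.
move=> fg; rewrite -[leRHS]mul1r; apply: hnorm_dom => // i.
by rewrite mul1r.
Qed.

(** B ranges over the finite sets that avoid A. *)
Lemma ell2_tail f (e : R) : 0 < e -> exists A, forall B,
  (forall i, i \in B -> i \notin A) -> \sum_(i <- B) normc (f i) ^+ 2 <= e.
Proof.
move=> e0; have /cvgrPdist_lt/(_ e e0) := @ell2_sqnorm_cvg _ _ f.
move=> /filter_ex[A]; rewrite partial_sumE ltr_norml => /andP[_ hA].
exists A => B AB; have := partial_sum_le_sqnorm f (A `|` B)%fset.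
rewrite (big_fsetID _ [in A])/=.
have -> : [fset x in (A `|` B)%fset | x \in A]%fset = A.
  apply/fsetP => i; rewrite !inE /=; by case: (i \in A) => //=; rewrite andbF.
have -> : [fset x in (A `|` B)%fset | x \notin A]%fset = B.
  apply/fsetP => i; rewrite !inE /=; case: (boolP (i \in B)) => [/AB ->|_].
    by rewrite orbT.
  by rewrite orbF; case: (i \in A).
move: hA; lra.
Qed.

(** A finite set A of indices carries f up to a small tail.  On A finitely many
    coordinates of h y tend to 0; off A they are dominated by the tail of f. *)
Lemma ell2_dominated_cvg (T : Type) (F : set_system T) {FF : Filter F}
    (h : T -> ell2 R I) f :
  (\forall y \near F, forall i, normc (h y i) <= normc (f i)) ->
  (forall i, normc (h y i) @[y --> F] --> (0 : R)) ->
  hnorm (h y) @[y --> F] --> (0 : R).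
Proof.
move=> hf h0; apply/cvgrPdist_le => e e0.
have e2 : 0 < e ^+ 2 / 2 by rewrite divr_gt0 ?exprn_gt0.
have [A fA] := ell2_tail f e2.
have /cvgrPdist_le/(_ _ e2) : \sum_(i <- A) normc (h y i) ^+ 2 @[y --> F]
    --> (\sum_(i <- A) 0 : R).
  apply: cvg_sum_seq => i; under eq_fun do rewrite expr2.
  have := cvgM (h0 i) (h0 i); rewrite mulr0 => hh; exact: hh.
rewrite big1// => hA; near=> y.
have hyf : forall i, normc (h y i) <= normc (f i) by near: y.
have : `|0 - \sum_(i <- A) normc (h y i) ^+ 2| <= e ^+ 2 / 2.
  by near: y; exact: hA.
rewrite !sub0r !normrN => /(le_trans (ler_norm _)) hAy.
rewrite ger0_norm ?hnorm_ge0//; apply: ell2_norm_le => [|B]; first exact: ltW.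
rewrite (big_fsetID _ [in A])/= [leRHS]splitr lerD//.
  apply: le_trans hAy; apply: le_partial_sum => [i|]; first exact: sqr_ge0.
  by apply/fsubsetP => i; rewrite !inE /= => /andP[].
apply: (@le_trans _ _
  (\sum_(i <- [fset x in B | x \notin A]%fset) normc (f i) ^+ 2)).
  by rewrite ler_sum// => i _; rewrite ler_sqr ?nnegrE ?normc_ge0.
by apply: fA => i; rewrite !inE /= => /andP[].
Unshelve. all: by end_near. Qed.

End dominated_convergence.

Section hilbert_facts.
Variables (R : realType) (H : hilbertType R).
Implicit Types f g : H.

Lemma hnormB_cvg (T : Type) (F : set_system T) (FF : Filter F) (u : T -> H) f :
  hnorm (u y - f) @[y --> F] --> (0 : R) -> u @ F --> f.
Proof.
move=> /cvgrPdist_lt uf; apply/cvgrPdist_lt => e /gt0_complexE[e0 ->].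
apply: filterS (uf _ e0) => y; rewrite sub0r normrN ger0_norm ?hnorm_ge0//.
by rewrite distrC hnormE ltcR.
Qed.

Lemma cvg_hnormB (T : Type) (F : set_system T) (FF : Filter F) (u : T -> H) f :
  u @ F --> f -> hnorm (u y - f) @[y --> F] --> (0 : R).
Proof.
move=> /cvgrPdist_lt uf; apply/cvgrPdist_lt => e e0.
have := uf e%:C; rewrite ltcR => /(_ e0); apply: filterS => y.
by rewrite sub0r normrN ger0_norm ?hnorm_ge0// distrC hnormE ltcR.
Qed.

Lemma inner_CauchySchwarz f g : normc (inner f g) <= hnorm f * hnorm g.
Proof.
rewrite -ler_sqr ?nnegrE ?normc_ge0 ?mulr_ge0 ?hnorm_ge0// -lecR.
rewrite rmorphXn /= -normcR; apply: le_trans (dot_CauchySchwarz _ _ _) _.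
by rewrite !innerE !hnormE exprMn rmorphM !rmorphXn.
Qed.

Lemma cvg_inner (T : Type) (F : set_system T) (FF : Filter F) (u : T -> H) f g :
  u @ F --> f -> (inner (u y) g : R[i]^o) @[y --> F] --> (inner f g : R[i]^o).
Proof.
move=> /cvgrPdist_lt uf; apply/cvg_complexP => e e0.
have d0 : 0 < e / (hnorm g + 1) by rewrite divr_gt0// ltr_wpDl ?hnorm_ge0.
have := uf (e / (hnorm g + 1))%:C; rewrite ltcR => /(_ d0); apply: filterS => y.
rewrite hnormE ltcR => fy; rewrite -linearBl /=.
apply: le_lt_trans (inner_CauchySchwarz _ _) _.
apply: (@le_lt_trans _ _ (hnorm (f - u y) * (hnorm g + 1))).
  by rewrite ler_wpM2l ?hnorm_ge0// lerDl.
by rewrite -ltr_pdivlMr// ltr_wpDl ?hnorm_ge0.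
Qed.

End hilbert_facts.

Section multipliers.
Variables (R : realType) (I : choiceType).

Definition contractive (m : I -> R[i]) := forall i, normc (m i) <= 1.

Lemma sq_summable_mul (m : I -> R[i]) (f : ell2 R I) : contractive m ->
  (fun i => m i * f i) \in @sq_summable R I.
Proof.
move=> m1; apply: (@sq_summable_dom _ _ 1 _ f) => [i|].
  by rewrite normcM ler_wpM2r ?normc_ge0.
exact: ell2_sq_summable.
Qed.

Definition multiplier m (m1 : contractive m) (f : ell2 R I) : ell2 R I :=
  Ell2 (sq_summable_mul f m1).

Lemma multiplier_linear m (m1 : contractive m) : linear (multiplier m1).
Proof.
move=> c f g; apply: ell2P => i /=; rewrite [LHS]mulrDr.
by congr (_ + _); rewrite mulrCA.
Qed.

HB.instance Definition _ m (m1 : contractive m) :=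
  GRing.isLinear.Build R[i] (ell2 R I) (ell2 R I) _ (multiplier m1)
    (multiplier_linear m1).

Lemma eq_inner (f g f' g' : ell2 R I) :
  (forall i, f i * (g i)^* = f' i * (g' i)^*) -> inner f g = inner f' g'.
Proof.
by move=> fg; congr (summability.sum _); apply/funext => i; exact: fg.
Qed.

End multipliers.

(** * The diagonal group and its spectral family *)

Section diagonal_group.
Variables (R : realType) (I : choiceType) (lam : I -> R).
Local Notation H := (ell2 R I).
Implicit Types (f g : H) (t s x y : R).

Lemma phase_contractive t : contractive (fun i => expi (t * lam i)).
Proof. by move=> i; rewrite normc_expi. Qed.

Definition diag_group t : {linear H -> H} := multiplier (phase_contractive t).

Lemma diag_groupE t f i : diag_group t f i = expi (t * lam i) * f i.
Proof. by []. Qed.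

Definition below x i : R[i] := (lam i <= x)%R%:R.

Lemma normc_nat (n : nat) : normc (n%:R : R[i]) = n%:R.
Proof. by rewrite -(rmorph_nat (real_complex R)) normc_real normr_nat. Qed.

Lemma below_contractive x : contractive (below x).
Proof. by move=> i; rewrite normc_nat lern1 leq_b1. Qed.

Definition diag_proj x : {linear H -> H} := multiplier (below_contractive x).

Lemma diag_projE x f i : diag_proj x f i = below x i * f i.
Proof. by []. Qed.

Lemma diag_group_inner t f g : inner (diag_group t f) (diag_group t g) = inner f g.
Proof.
apply: eq_inner => i; rewrite !diag_groupE rmorphM /= mulrACA.
by rewrite -sqr_normc normcR normc_expi expr1n mul1r.
Qed.

Lemma hnorm_diag_group t f : hnorm (diag_group t f) = hnorm f.
Proof.
apply/eqP; rewrite eq_le; apply/andP; split; apply: hnorm_le => i;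
  by rewrite diag_groupE normcM normc_expi mul1r.
Qed.

Lemma diag_group_unitary : unitary_group diag_group.
Proof.
split.
- by move=> f; apply: ell2P => i; rewrite diag_groupE mul0r expi0 mul1r.
- by move=> t s f; apply: ell2P => i; rewrite !diag_groupE mulrDl expiD mulrA.
- exact: diag_group_inner.
- move=> f t; apply: hnormB_cvg.
  apply: (@ell2_dominated_cvg _ _ _ _ _ _ (2%:R *: f)).
    apply: nearW => s i.
    rewrite (_ : _ i = (expi (s * lam i) - expi (t * lam i)) * f i); last first.
      by rewrite mulrBl.
    rewrite ell2ZE !normcM ler_wpM2r ?normc_ge0// normc_nat.
    by apply: le_trans (normcB _ _) _; rewrite !normc_expi.
  move=> i; apply/cvgrPdist_lt => e e0.
  have d0 : 0 < e / (`|lam i| * normc (f i) + 1).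
    by rewrite divr_gt0// ltr_wpDl// mulr_ge0 ?normc_ge0.
  near=> s; have ts : `|s - t| < e / (`|lam i| * normc (f i) + 1).
    by rewrite distrC; near: s; exact: cvgr_dist_lt.
  rewrite sub0r normrN ger0_norm ?normc_ge0//.
  rewrite (_ : _ i = (expi (s * lam i) - expi (t * lam i)) * f i); last first.
    by rewrite mulrBl.
  rewrite normcM; apply: (@le_lt_trans _ _ (`|s - t| * (`|lam i| * normc (f i) + 1))).
    rewrite mulrDr mulr1 mulrA; apply: ler_wpDr => //.
    rewrite ler_wpM2r ?normc_ge0//; apply: le_trans (expi_lipschitz _ _) _.
    by rewrite -mulrBl normrM.
  by rewrite -ltr_pdivlMr// ltr_wpDl// mulr_ge0 ?normc_ge0.
Unshelve. all: by end_near. Qed.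

Lemma below_min x y i : below x i * below y i = below (Num.min x y) i.
Proof. by rewrite /below le_min -natrM mulnb. Qed.

Lemma below_conj x i : Num.conj (below x i) = below x i.
Proof. exact: rmorph_nat. Qed.

(** Cutting off frequencies is dominated by the vector itself, so convergence
    of the cut-offs at each frequency suffices. *)
Lemma diag_proj_cvg (F : set_system R) {FF : Filter F} f (g : H) :
  (forall i, g i = 0 \/ g i = f i) ->
  (forall i, \forall y \near F, below y i * f i = g i) ->
  diag_proj y f @[y --> F] --> g.
Proof.
move=> gf ev; apply: hnormB_cvg; apply: (ell2_dominated_cvg (f := f)).
  apply: nearW => y i; rewrite (_ : _ i = below y i * f i - g i)//.
  rewrite /below; case: (lam i <= y); case: (gf i) => ->;
    by rewrite ?mul1r ?mul0r ?subrr ?subr0 ?sub0r ?normcN ?normc0 ?normc_ge0.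
move=> i; apply: cvg_near_cst; apply: filterS (ev i) => y e.
by rewrite (_ : _ i = below y i * f i - g i)// e subrr normc0.
Qed.

Definition diag_spectral : spectral_family H.
Proof.
apply: (@Build_spectral_family _ _ diag_proj).
- move=> x f g; apply: eq_inner => i; rewrite !diag_projE rmorphM /= below_conj.
  by rewrite mulrCA mulrA.
- by move=> x y f; apply: ell2P => i; rewrite !diag_projE mulrA below_min.
- move=> f x; apply: diag_proj_cvg => i; rewrite ?diag_projE.
    by rewrite /below; case: (_ <= _); rewrite ?mul1r ?mul0r; [right|left].
  have [lx|xl] := leP (lam i) x.
    near=> y; congr (_ * _); by rewrite /below lx (le_trans lx).
  near=> y; congr (_ * _); rewrite /below !leNgt xl.
  by rewrite (_ : y < lam i)//; near: y; exact: nbhs_right_lt.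
- move=> f; apply: diag_proj_cvg => i; first by left.
  near=> y; rewrite /below leNgt (_ : y < lam i) ?mul0r//.
  by near: y; apply: nbhs_ninfty_lt; exact: num_real.
- move=> f; apply: diag_proj_cvg => i; first by right.
  by near=> y; rewrite /below (_ : lam i <= y) ?mul1r.
Unshelve. all: by end_near. Defined.

Lemma diag_spectralE x f : diag_spectral x f = diag_proj x f.
Proof. by []. Qed.

End diagonal_group.

(** * The spectral integral of the diagonal group *)

Section step_integrator.
Variables (R : realType) (phi : R -> R[i]) (L l : R).
Hypothesis phi_lipschitz : forall a b, normc (phi a - phi b) <= L * `|a - b|.

Let step (x : R) : R := (l <= x)%R%:R.

(** Integrating against a unit step at l evaluates the integrand at l; only the
    partition interval that contains l contributes to the error. *)
Lemma step_RS_error (d : R) (n : nat) (x xi : nat -> R) : 0 <= L -> 0 <= d ->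
  (forall k, (k < n)%N -> x k <= xi k <= x k.+1 /\ x k.+1 - x k < d) ->
  normc (\sum_(k < n) (step (x k.+1) - step (x k))%:C * phi (xi k)
    - (step (x n) - step (x 0%N))%:C * phi l) <= L * d.
Proof.
move=> L0 d0 xd.
have tele (V : zmodType) (F : nat -> V) : F n - F 0%N = \sum_(k < n) (F k.+1 - F k).
  by rewrite -(telescope_sumr _ (leq0n n)) big_mkord.
rewrite (tele _ (fun k => step (x k))) rmorph_sum mulr_suml -sumrB /=.
apply: le_trans (normc_sum _ _) _.
apply: (@le_trans _ _ (\sum_(k < n) L * d * (step (x k.+1) - step (x k)))).
  apply: ler_sum => k _; have [/andP[xk kx] kd] := xd k (ltn_ord k).
  rewrite -mulrBr normcM normc_real; rewrite /step.
  have [lx|xl] := leP l (x k).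
    by rewrite (le_trans lx (le_trans xk kx)) subrr normr0 mul0r mulr0.
  have [lx|_] := leP l (x k.+1); last by rewrite subrr normr0 mul0r mulr0.
  rewrite subr0 normr1 mul1r mulr1; apply: le_trans (phi_lipschitz _ _) _.
  rewrite ler_wpM2l// ltW//; apply: le_lt_trans kd.
  by rewrite ler_norml; apply/andP; split; lra.
rewrite -mulr_sumr -(tele _ (fun k => step (x k))) ler_piMr ?mulr_ge0//.
by rewrite lerBlDr /step -[1]/(1%:R) -natrD ler_nat (leq_trans (leq_b1 _))// leq_addr.
Qed.

End step_integrator.

Section diagonal_resolution.
Variables (R : realType) (I : choiceType) (lam : I -> R).
Local Notation H := (ell2 R I).
Local Notation U := (diag_group lam).
Local Notation E := (diag_proj lam).

Lemma belowE x i : below lam x i = ((lam i <= x)%R%:R : R)%:C.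
Proof. by rewrite rmorph_nat. Qed.

(** In each coordinate the spectral family is a unit step at the frequency of that
    coordinate, so step_RS_error applies with a bound uniform in the coordinate. *)
Lemma diag_RS_error t (f : H) (d : R) (n : nat) (x xi : nat -> R) : 0 <= d ->
  (forall k, (k < n)%N -> x k <= xi k <= x k.+1 /\ x k.+1 - x k < d) ->
  hnorm (\sum_(k < n) expi (t * xi k) *: (E (x k.+1) f - E (x k) f)
    - U t (E (x n) f - E (x 0%N) f)) <= `|t| * d * hnorm f.
Proof.
move=> d0 xd; apply: hnorm_dom => [|i]; first by rewrite mulr_ge0.
have lip a b : normc (expi (t * a) - expi (t * b)) <= `|t| * `|a - b|.
  by apply: le_trans (expi_lipschitz _ _) _; rewrite -mulrBr normrM.
have := step_RS_error (lam i) lip (normr_ge0 t) d0 xd.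
move=> /(ler_wpM2r (normc_ge0 (f i))); apply: le_trans.
rewrite -normcM le_eqVlt; apply/orP; left; apply/eqP; congr normc.
rewrite mulrBl; congr (_ - _).
  rewrite [LHS]ell2_sumE mulr_suml; apply: eq_bigr => k _.
  rewrite ell2ZE ell2DE ell2NE !diag_projE !belowE rmorphB /=.
  by rewrite -mulrBl mulrCA mulrA.
rewrite [LHS]diag_groupE ell2DE ell2NE !diag_projE !belowE rmorphB /=.
by rewrite -mulrBl mulrCA mulrA.
Qed.

Lemma diag_RS_integral t (f g : H) (a b : R) :
  is_RS_integral (fun x => expi (t * x) : R[i]^o) (fun x => inner (E x f) g) a b
    (inner (U t (E b f - E a f)) g : R[i]^o).
Proof.
move=> e e0; pose c := `|t| * hnorm f * hnorm g + 1.
have c0 : 0 < c by rewrite ltr_wpDl// !mulr_ge0// hnorm_ge0.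
exists (e / c) => [|n x xi <- <- xd]; first by rewrite divr_gt0.
have d0 : 0 <= e / c by rewrite ltW// divr_gt0.
rewrite (_ : _ - _ = inner (\sum_(k < n) expi (t * xi k) *: (E (x k.+1) f - E (x k) f)
    - U t (E (x n) f - E (x 0%N) f)) g); last first.
  rewrite linearBl /=; congr (_ - _); rewrite linear_sumlz /=.
  by apply: eq_bigr => k _; rewrite linearZl_LR /= linearBl [LHS]mulrC.
rewrite [X in X < _]normcR ltcR; apply: le_lt_trans (inner_CauchySchwarz _ _) _.
apply: (@le_lt_trans _ _ (`|t| * (e / c) * hnorm f * hnorm g)).
  by rewrite ler_wpM2r ?hnorm_ge0// diag_RS_error.
rewrite (_ : `|t| * (e / c) * hnorm f * hnorm g
  = e * ((`|t| * hnorm f * hnorm g) / c)); last first.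
  by move: (c^-1) (hnorm f) (hnorm g) => c' u v; ring.
by rewrite gtr_pMr// ltr_pdivrMr// mul1r ltrDl.
Qed.

(** U^t is an isometry and the projections tend to 0 and to the identity at the two
    ends of the line, so the integrals over bounded intervals converge. *)
Lemma diag_spectral_resolution : spectral_resolution U (diag_spectral lam).
Proof.
move=> t f g; exists (fun a b => inner (U t (E b f - E a f)) g : R[i]^o).
  by move=> a b _; exact: diag_RS_integral.
apply: cvg_inner; apply: hnormB_cvg.
under eq_fun do rewrite -linearB hnorm_diag_group.
apply: cvg_hnormB; rewrite -[X in _ --> X]subr0; apply: cvgB.
  apply: (cvg_comp snd (fun b => E b f)); first exact: cvg_snd.
  exact: (spectral_proj_pinfty (diag_spectral lam)).
apply: (cvg_comp fst (fun b => E b f)); first exact: cvg_fst.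
exact: (spectral_proj_ninfty (diag_spectral lam)).
Qed.

End diagonal_resolution.

(** * Time averages of the diagonal group *)

Section riemann_stieltjes.
Variables (R : realType) (V : normedModType R[i]).

Lemma uniform_partition (a b d : R) : a < b -> 0 < d -> exists n (x : nat -> R),
  [/\ x 0%N = a, x n = b &
      forall k, (k < n)%N -> x k <= x k <= x k.+1 /\ x k.+1 - x k < d].
Proof.
move=> ab d0; pose n := (Num.truncn ((b - a) / d)).+1.
have n0 : 0 < n%:R :> R by rewrite ltr0n.
exists n, (fun k => a + k%:R * ((b - a) / n%:R)); split.
- by rewrite mul0r addr0.
- by rewrite mulrC divfK ?gt_eqF// addrC subrK.
move=> k _; have w0 : 0 < (b - a) / n%:R by rewrite divr_gt0// subr_gt0.
split; first by rewrite lexx lerD2l ler_pM2r// ler_nat leqnSn.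
rewrite opprD addrACA subrr add0r -mulrBl -natr1 addrAC subrr add0r mul1r.
rewrite ltr_pdivrMr// mulrC -ltr_pdivrMr//.
have ba0 : 0 <= (b - a) / d by rewrite ltW// divr_gt0// subr_gt0.
by have /andP[] := Num.Theory.truncn_itv ba0.
Qed.

(** Both integrals are close to the same sum over a fine uniform partition. *)
Lemma RS_integral_unique (phi : R -> V) (G : R -> R[i]) (a b : R) (v w : V) :
  a < b -> is_RS_integral phi G a b v -> is_RS_integral phi G a b w -> v = w.
Proof.
move=> ab hv hw; apply/eqP; rewrite -subr_eq0 -normr_eq0; apply: contraT => vw0.
have /gt0_complexE[r0 rE] : 0 < `|v - w| by rewrite lt_def vw0 normr_ge0.
set r := complex.Re _ in r0 rE.
have r2 : 0 < r / 2 by rewrite divr_gt0.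
have [d d0 {}hv] := hv _ r2; have [d' d'0 {}hw] := hw _ r2.
have dd0 : 0 < Num.min d d' by rewrite lt_min d0 d'0.
have [n [x [xa xb xd]]] := uniform_partition ab dd0.
have /(_ xa xb) hv' := hv n x x; have /(_ xa xb) hw' := hw n x x.
have : `|v - w| < r%:C.
  rewrite (splitr r) rmorphD.
  apply: (@le_lt_trans _ _ _ _ _
    (ler_distD (\sum_(k < n) (G (x k.+1) - G (x k)) *: phi (x k)) _ _)).
  rewrite ltrD//.
    by rewrite distrC; apply: hv' => k /xd[? +]; rewrite lt_min => /andP[].
  by apply: hw' => k /xd[? +]; rewrite lt_min => /andP[].
by rewrite rE ltxx.
Qed.

Lemma riemann_integralE (phi : R -> V) (a b : R) (v : V) : a < b ->
  is_RS_integral phi (fun x => x%:C) a b v -> riemann_integral phi a b = v.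
Proof.
by move=> ab hv; apply: xget_unique => // w hw; exact: RS_integral_unique hw hv.
Qed.

End riemann_stieltjes.

Section time_averages.
Variables (R : realType) (I : choiceType) (lam : I -> R).
Hypothesis lam_gt0 : forall i, 0 < lam i.
Local Notation H := (ell2 R I).
Local Notation U := (diag_group lam).

(** The mean of exp(i tau l) over tau in [s, t], for l nonzero and s < t. *)
Definition avg_factor (t s l : R) : R[i] :=
  (expi (t * l) - expi (s * l)) / ('i * ((t - s) * l)%:C).

Lemma normc_i : normc 'i = 1 :> R.
Proof. by rewrite /= expr0n expr1n add0r sqrtr1. Qed.

Lemma normc_avg_factor t s l : 0 < l -> s < t -> normc (avg_factor t s l)
  = `|sin ((t - s) * l / 2)| / ((t - s) * l / 2).
Proof.
move=> l0 st; have tsl : 0 < (t - s) * l by rewrite mulr_gt0// subr_gt0.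
rewrite /avg_factor normcM normcV normcM normc_i mul1r normc_real gtr0_norm//.
by rewrite expi_chord -mulrBl invf_div mulrA [_ * 2]mulrC.
Qed.

Lemma avg_factor_contractive t s : s < t ->
  contractive (fun i => avg_factor t s (lam i)).
Proof.
move=> st i; rewrite normc_avg_factor//.
have x0 : 0 < (t - s) * lam i / 2 by rewrite divr_gt0// mulr_gt0// subr_gt0.
by rewrite ler_pdivrMr// mul1r -[leRHS]gtr0_norm// sin_norm_le.
Qed.

(** The first bound is uniform in the frequency l and gives domination; the second
    tends to 0 with the mesh d at each fixed l. *)
Lemma phase_RS_error t s (l d : R) (n : nat) (x xi : nat -> R) : 0 < l -> s < t ->
  x 0%N = s -> x n = t ->
  (forall k, (k < n)%N -> x k <= xi k <= x k.+1 /\ x k.+1 - x k < d) ->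
  normc (\sum_(k < n) (x k.+1 - x k)%:C * expi (xi k * l)
    - (t - s)%:C * avg_factor t s l) <= 2 * (t - s) * Num.min 1 `|d * l|.
Proof.
move=> l0 st xs xt xd; have ts0 : 0 < t - s by rewrite subr_gt0.
have dx0 k : (k < n)%N -> 0 <= x k.+1 - x k.
  by move=> /xd[/andP[h1 h2] _]; rewrite subr_ge0 (le_trans h1).
have sumdx : \sum_(k < n) (x k.+1 - x k) = t - s.
  by rewrite -xs -xt -(telescope_sumr _ (leq0n n)) big_mkord.
have [d0|d0] := ltP 0 d; last first.
  suff : n = 0%N by move=> n0; move: st; rewrite -xs -xt n0 ltxx.
  case: n xd dx0 {xt sumdx} => // n xd dx0; have [_] := xd _ (ltn0Sn n).
  by move=> /lt_le_trans/(_ d0); rewrite ltNge dx0.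
rewrite minr_pMr ?mulr_ge0 ?(ltW ts0)// mulr1 le_min; apply/andP; split.
  apply: le_trans (normcB _ _) _; rewrite mulr_natl mulr2n lerD//.
    apply: le_trans (normc_sum _ _) _; rewrite -[leRHS]sumdx ler_sum// => k _.
    by rewrite normcM normc_expi mulr1 normc_real ger0_norm ?dx0.
  rewrite normcM normc_real gtr0_norm// ler_piMr ?(ltW ts0)//.
  rewrite normc_avg_factor//.
  have x0 : 0 < (t - s) * l / 2 by rewrite divr_gt0// mulr_gt0.
  by rewrite ler_pdivrMr// mul1r -[leRHS]gtr0_norm// sin_norm_le.
have il0 : 'i * l%:C != 0 :> R[i].
  by apply/eqP => /(congr1 (@normc R)); rewrite normcM normc_i normc_real normc0
    mul1r => /eqP; rewrite normr_eq0 gt_eqF.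
have -> : (t - s)%:C * avg_factor t s l
    = \sum_(k < n) ('i * l%:C)^-1 * (expi (x k.+1 * l) - expi (x k * l)).
  rewrite -mulr_sumr -(big_mkord xpredT
    (fun k => expi (x k.+1 * l) - expi (x k * l))).
  rewrite (telescope_sumr (fun k => expi (x k * l)) (leq0n n)) xs xt.
  rewrite /avg_factor rmorphM /=; have ts1 : (t - s)%:C != 0 :> R[i].
    by rewrite (inj_eq (@complexI R) (t - s) 0) gt_eqF.
  by rewrite [X in _ * (_ / X)]mulrCA invfM mulrA mulrCA !mulrA mulVf// mul1r mulrC.
rewrite -sumrB; apply: le_trans (normc_sum _ _) _.
rewrite -sumdx mulr_sumr mulr_suml ler_sum// => k _.
have [/andP[h1 h2] h3] := xd k (ltn_ord k).
have -> : (x k.+1 - x k)%:C * expi (xi k * l)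
    = ('i * l%:C)^-1 * ((x k.+1 * l - x k * l)%:C * ('i * expi (xi k * l))).
  rewrite -mulrBl rmorphM /=.
  rewrite (_ : _ * ('i * _) = 'i * l%:C * ((x k.+1 - x k)%:C * expi (xi k * l))).
    by rewrite mulKf.
  by rewrite mulrACA [RHS]mulrACA; congr (_ * _); rewrite mulrC.
rewrite -mulrBr normcM normcV normcM normc_i mul1r normc_real gtr0_norm//.
have := @expi_increment _ (x k * l) (x k.+1 * l) (xi k * l).
rewrite !ler_pM2r// h1 h2 => /(_ isT) /(ler_wpM2l (_ : 0 <= l^-1)).
rewrite invr_ge0 => /(_ (ltW l0))/le_trans; apply.
rewrite -mulrBl gtr0_norm ?mulr_gt0//.
rewrite (_ : l^-1 * _ = 2 * (x k.+1 - x k) * ((x k.+1 - x k) * l)); last first.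
  by field; rewrite gt_eqF.
by rewrite ler_wpM2l ?mulr_ge0 ?dx0// ler_wpM2r ?ltW.
Qed.

Lemma min_contractive (d : R) :
  contractive (fun i => (Num.min 1 `|d * lam i|)%:C).
Proof.
move=> i; rewrite normc_real ger0_norm; first by rewrite ge_min lexx.
by rewrite le_min ler01 normr_ge0.
Qed.

Lemma hnorm_min_cvg (f : H) :
  hnorm (multiplier (min_contractive d) f) @[d --> 0^'+] --> (0 : R).
Proof.
apply: (ell2_dominated_cvg (f := f)).
  apply: nearW => d i; rewrite (_ : _ i = (Num.min 1 `|d * lam i|)%:C * f i)//.
  by rewrite normcM ler_piMl ?normc_ge0// min_contractive.
move=> i; apply/cvgrPdist_lt => e e0.
have c0 : 0 < lam i * normc (f i) + 1.
  by rewrite ltr_wpDl// mulr_ge0 ?normc_ge0// ltW.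
near=> d; have d0 : 0 < d by near: d; exact: nbhs_right_gt.
have de : d < e / (lam i * normc (f i) + 1).
  by near: d; apply: nbhs_right_lt; rewrite divr_gt0.
rewrite sub0r normrN ger0_norm ?normc_ge0//.
rewrite (_ : _ i = (Num.min 1 `|d * lam i|)%:C * f i)// normcM normc_real.
rewrite ger0_norm ?le_min ?ler01 ?normr_ge0//.
apply: (@le_lt_trans _ _ (d * (lam i * normc (f i) + 1))); last first.
  by rewrite -ltr_pdivlMr.
rewrite mulrDr mulrA mulr1; apply: ler_wpDr; first exact: ltW.
rewrite ler_wpM2r ?normc_ge0// ge_min; apply/orP; right.
by rewrite gtr0_norm// mulr_gt0.
Unshelve. all: by end_near. Qed.

(** The Riemann sums act diagonally with the coordinate errors of phase_RS_error;
    by hnorm_min_cvg these errors are small in norm for a fine mesh. *)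
Lemma diag_time_average t s (st : s < t) (f : H) :
  time_average U t s f = multiplier (avg_factor_contractive st) f.
Proof.
have ts0 : 0 < t - s by rewrite subr_gt0.
have tsC : (t - s)%:C != 0 :> R[i].
  by rewrite (inj_eq (@complexI R) (t - s) 0) gt_eqF.
rewrite /time_average.
rewrite (@riemann_integralE _ _ _ _ _
  ((t - s)%:C *: multiplier (avg_factor_contractive st) f))//.
  by rewrite scalerA -rmorphM mulVf ?gt_eqF//= scale1r.
move=> e e0.
have e2 : 0 < e / (2 * (t - s)) by rewrite divr_gt0// mulr_gt0.
have /cvgrPdist_lt/(_ _ e2) := hnorm_min_cvg f.
move=> /(filterI (nbhs_right_gt (0 : R)))/filter_ex[d [d0]].
rewrite sub0r normrN ger0_norm ?hnorm_ge0// => hd.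
exists d => // n x xi xs xt xd; rewrite hnormE ltcR.
apply: (@le_lt_trans _ _ (2 * (t - s) * hnorm (multiplier (min_contractive d) f))).
  apply: hnorm_dom => [|i]; first by rewrite mulr_ge0// ltW.
  rewrite (_ : _ i = (\sum_(k < n) (x k.+1 - x k)%:C * expi (xi k * lam i)
      - (t - s)%:C * avg_factor t s (lam i)) * f i); last first.
    rewrite mulrBl; congr (_ - _); last by rewrite -mulrA.
    rewrite [LHS]ell2_sumE mulr_suml; apply: eq_bigr => k _.
    by rewrite ell2ZE diag_groupE mulrA rmorphB.
  rewrite (_ : multiplier _ f i = (Num.min 1 `|d * lam i|)%:C * f i)//.
  rewrite !normcM [leRHS]mulrA; apply: ler_wpM2r; first exact: normc_ge0.
  rewrite normc_real (ger0_norm (_ : 0 <= Num.min _ _)); last first.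
    by rewrite le_min ler01 normr_ge0.
  exact: phase_RS_error.
by rewrite mulrC -ltr_pdivlMr// mulr_gt0.
Qed.

End time_averages.

(** * The constant rho, unit vectors and weighted norms *)

Section rho_facts.
Variables (R : realType) (alpha : R).
Hypothesis halpha : 0 <= alpha <= 2.

Let pihalf_ok : [set x : R | 0 < x /\ sin x != 0] (pi / 2).
Proof. by rewrite /= sin_pihalf oner_neq0 divr_gt0// pi_gt0. Qed.

Lemma rho_greatest (c : R) :
  (forall x, 0 < x -> c * sin x ^+ 2 <= x `^ (2 - alpha)) -> c <= rho alpha.
Proof.
move=> hc; apply: lb_le_inf; first by eexists; exists (pi / 2) => //; exact: pihalf_ok.
move=> _ [x [x0 sx] <-]; rewrite ler_pdivlMr ?hc//.
by rewrite lt_def sqr_ge0 andbT expf_neq0.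
Qed.

Lemma rho_le x : 0 < x -> rho alpha * sin x ^+ 2 <= x `^ (2 - alpha).
Proof.
move=> x0; have [->|sx] := eqVneq (sin x) 0.
  by rewrite expr0n mulr0 powR_ge0.
rewrite -ler_pdivlMr; last by rewrite lt_def sqr_ge0 andbT expf_neq0.
apply: ge_inf; last by exists x.
by exists 0 => _ [y _ <-]; rewrite divr_ge0 ?powR_ge0 ?sqr_ge0.
Qed.

(** For x <= 1 compare with x ^+ 2, which bounds the squared sine; for x >= 1
    compare with 1.  This makes rho, hence the constant B, positive. *)
Lemma rho_ge1 : 1 <= rho alpha.
Proof.
have /andP[a0 a2] := halpha.
apply: rho_greatest => x x0; rewrite mul1r -[_ ^+ 2]real_normK ?num_real//.
have [x1|x1] := leP x 1.
  apply: (@le_trans _ _ (x ^+ 2)).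
    by rewrite ler_sqr ?nnegrE ?(ltW x0)// -[leRHS]gtr0_norm// sin_norm_le.
  rewrite -powR_mulrn ?(ltW x0)//; apply: ger_powR; first by rewrite x0.
  by rewrite lerBlDr lerDl.
apply: (@le_trans _ _ 1); first by rewrite expr_le1// sin_max.
by rewrite -[leLHS](powRr0 x); apply: ler_powR; [exact: ltW|rewrite subr_ge0].
Qed.

End rho_facts.

Section delta.
Variables (R : realType) (I : choiceType).
Local Notation H := (ell2 R I).

Lemma delta_sq_bounded (i : I) : sq_bounded (1 : R) (fun j => (j == i)%:R).
Proof.
move=> A; have [iA|iA] := boolP (i \in A).
  rewrite (bigD1_seq i)//= eqxx normc1 expr1n big1 ?addr0// => j /negPf ->.
  by rewrite normc0 expr0n.
rewrite big1_seq ?ler01// => j /andP[_ jA].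
by rewrite (negPf (_ : j != i)) ?normc0 ?expr0n//; apply: contraNneq iA => <-.
Qed.

Lemma delta_sq_summable (i : I) : (fun j => (j == i)%:R) \in @sq_summable R I.
Proof. by apply/sq_summableP; exists 1; exact: delta_sq_bounded. Qed.

Definition delta (i : I) : H := Ell2 (delta_sq_summable i).

Lemma deltaE i j : delta i j = (j == i)%:R. Proof. by []. Qed.

Lemma hnorm_delta i : hnorm (delta i) = 1.
Proof.
apply/eqP; rewrite eq_le; apply/andP; split.
  by apply: ell2_norm_le => //; rewrite expr1n; exact: delta_sq_bounded.
by apply: le_trans (coord_le_norm (delta i) i); rewrite deltaE eqxx normc1.
Qed.

Lemma hnormZ (c : R[i]) (f : H) : hnorm (c *: f) = normc c * hnorm f.
Proof. exact: ell2_normZ. Qed.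

Lemma delta_neq0 i : delta i != 0.
Proof.
apply/eqP => /(congr1 (@hnorm R H)); rewrite hnorm_delta => /eqP.
by rewrite -(scale0r (delta i)) hnormZ normc0 mul0r oner_eq0.
Qed.

Lemma multiplier_delta (m : I -> R[i]) (m1 : contractive m) i :
  multiplier m1 (delta i) = m i *: delta i.
Proof.
apply: ell2P => j; rewrite ell2ZE deltaE.
rewrite (_ : multiplier _ _ j = m j * (j == i)%:R)//.
by case: eqVneq => [->//|_]; rewrite !mulr0.
Qed.

End delta.

Section weighted_space.
Variables (R : realType) (I : choiceType) (w : I -> R).
Hypothesis w_gt0 : forall i, 0 < w i.
Local Notation H := (ell2 R I).

Definition weighted (f : H) : I -> R[i] := fun i => (w i)%:C * f i.

Definition weighted_ell2 : {pred H} := [pred f | weighted f \in @sq_summable R I].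

(** The weighted family as a vector, with the default value 0 when it is not
    square-summable, that is, outside the subspace. *)
Definition weighted_vec (f : H) : H := insubd 0 (weighted f).

Definition weighted_norm (f : H) : R := hnorm (weighted_vec f).

Lemma weighted_vecE f i : f \in weighted_ell2 -> weighted_vec f i = (w i)%:C * f i.
Proof. by move=> fX; rewrite /weighted_vec -[ell2_val _]/(\val _) insubdK. Qed.

Lemma weighted_vecP (f g : H) : (forall i, g i = (w i)%:C * f i) ->
  f \in weighted_ell2 /\ weighted_vec f = g.
Proof.
move=> gE; have fX : f \in weighted_ell2.
  have wg : weighted f = g by apply: funext => i; rewrite gE.
  by rewrite -[_ \in _]/(weighted f \in @sq_summable R I) wg ell2_sq_summable.
by split => //; apply: ell2P => i; rewrite weighted_vecE.
Qed.

Lemma weighted_linear (c : R[i]) f g : f \in weighted_ell2 -> g \in weighted_ell2 ->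
  (c *: f + g \in weighted_ell2)
  /\ weighted_vec (c *: f + g) = c *: weighted_vec f + weighted_vec g.
Proof.
move=> fX gX; apply: weighted_vecP => i.
rewrite !ell2DE !ell2ZE !weighted_vecE// mulrDr; congr (_ + _).
by rewrite mulrCA.
Qed.

Lemma weighted_norm_subspace : subspace_norm weighted_ell2 weighted_norm.
Proof.
have X0 : 0 \in weighted_ell2 /\ weighted_vec 0 = 0.
  by apply: weighted_vecP => i; rewrite !ell20E mulr0.
have eq0 f : f \in weighted_ell2 -> weighted_norm f = 0 -> f = 0.
  move=> fX /ell2_norm_eq0 f0; apply: ell2P => i; rewrite ell20E.
  have := weighted_vecE i fX; rewrite f0 ell20E => /esym/eqP.
  by rewrite mulf_eq0 (inj_eq (@complexI R) (w i) 0) gt_eqF//= => /eqP.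
split => //.
- split; first exact: X0.1.
  by move=> c f g fX gX; exact: (weighted_linear c fX gX).1.
- by move=> f _; exact: hnorm_ge0.
- move=> c f fX; have := (weighted_linear c fX X0.1).2.
  by rewrite X0.2 !addr0 /weighted_norm => ->; rewrite hnormZ.
- move=> f g fX gX; have := (weighted_linear 1 fX gX).2.
  by rewrite !scale1r /weighted_norm => ->; exact: ell2_normD.
Qed.

Lemma weighted_delta i :
  delta R i \in weighted_ell2 /\ weighted_norm (delta R i) = w i.
Proof.
have [|dX dE] := @weighted_vecP (delta R i) ((w i)%:C *: delta R i).
  by move=> j; rewrite ell2ZE deltaE; case: eqVneq => [->|_]; rewrite ?mulr0.
split=> //; rewrite /weighted_norm dE hnormZ hnorm_delta mulr1 normc_real.
exact: gtr0_norm.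
Qed.

Lemma hnorm_multiplier_weighted (m : I -> R[i]) (m1 : contractive m) (K : R) f :
  0 <= K -> (forall i, normc (m i) <= K * w i) -> f \in weighted_ell2 ->
  hnorm (multiplier m1 f) <= K * weighted_norm f.
Proof.
move=> K0 mK fX; apply: hnorm_dom => // i.
rewrite (_ : multiplier _ _ i = m i * f i)// weighted_vecE// !normcM.
rewrite normc_real (gtr0_norm (w_gt0 i)) mulrA.
by rewrite ler_wpM2r ?normc_ge0.
Qed.

End weighted_space.

Lemma spectral_measure_itvoc (R : realType) (H : hilbertType R)
    (E : spectral_family H) (h : H) (a b : R) : a <= b ->
  spectral_measure E h `]a, b]%classic
    = (spectral_distribution E h b - spectral_distribution E h a)%:E.
Proof.
move=> ab; rewrite /spectral_measure /= /lebesgue_stieltjes_measure.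
rewrite /measure_extension/= measurable_mu_extE/=; last exact: is_ocitv.
by rewrite wlength_itv_bnd.
Qed.

(** * The sharp constant *)

Section power_weight.
Variables (R : realType) (alpha : R).
Hypothesis halpha : 0 <= alpha <= 2.

(** Every positive real is a frequency: the supremum of the multipliers over the
    atoms is then the one that defines rho, whatever the length of the time interval,
    and a uniform power law in that length becomes possible. *)
Definition frequency : Type := {x : R | 0 < x}.
HB.instance Definition _ := Choice.on frequency.

Definition freq (i : frequency) : R := val i.

Lemma freq_gt0 i : 0 < freq i.
Proof. exact: (valP i). Qed.

Definition power_weight (i : frequency) : R := freq i `^ (- (alpha / 2)).

Lemma power_weight_gt0 i : 0 < power_weight i.
Proof. by rewrite powR_gt0// freq_gt0. Qed.

Lemma sqr_power_weight i : power_weight i ^+ 2 = (freq i `^ alpha)^-1.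
Proof.
rewrite -powR_mulrn ?powR_ge0// -powRrM mulNr divfK//; exact: powRN.
Qed.

Definition sharp_const : R := 2 `^ alpha / rho alpha.

Lemma sharp_const_gt0 : 0 < sharp_const.
Proof.
by rewrite divr_gt0 ?powR_gt0// (lt_le_trans ltr01)// rho_ge1.
Qed.

(** The operator norm of the average over an interval of length T. *)
Definition sharp_bound (T : R) : R := Num.sqrt (sharp_const * T `^ (- alpha)).

Lemma sqr_sharp_bound T : 0 < T ->
  sharp_bound T ^+ 2 = 2 `^ alpha / rho alpha / T `^ alpha.
Proof.
move=> T0; rewrite sqr_sqrtr ?powRN// mulr_ge0 ?ltW ?sharp_const_gt0//.
by rewrite invr_gt0 powR_gt0.
Qed.

Let half_period (T l : R) : 0 < T -> 0 < l ->
  (T * l / 2) `^ alpha * 2 `^ alpha = T `^ alpha * l `^ alpha.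
Proof.
move=> T0 l0; rewrite -!powRM ?(ltW T0) ?(ltW l0) ?divfK//.
by rewrite ltW// divr_gt0// mulr_gt0.
Qed.

Let powR2B (x : R) : 0 < x -> x `^ (2 - alpha) = x ^+ 2 / x `^ alpha.
Proof.
by move=> x0; rewrite powRB ?(gt_eqF x0) ?implybT// powR_mulrn// ltW.
Qed.

(** With x = T l / 2 this is the square root of rho * sin^2 x <= x^(2 - alpha),
    rewritten in terms of T and l. *)
Lemma sinc_le_sharp_bound (T : R) i : 0 < T ->
  `|sin (T * freq i / 2)| / (T * freq i / 2) <= sharp_bound T * power_weight i.
Proof.
move=> T0; have l0 := freq_gt0 i; set x := T * freq i / 2.
have x0 : 0 < x by rewrite divr_gt0// mulr_gt0.
rewrite -ler_sqr ?nnegrE ?mulr_ge0 ?sqrtr_ge0 ?invr_ge0 ?(ltW x0)//; last first.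
  exact: ltW (power_weight_gt0 i).
rewrite !exprMn real_normK ?num_real// sqr_sharp_bound// sqr_power_weight.
have r0 : 0 < rho alpha by rewrite (lt_le_trans ltr01)// rho_ge1.
have := rho_le alpha x0; rewrite powR2B//.
have := half_period T0 l0; rewrite -/x.
have Ta := powR_gt0 alpha T0; have la := powR_gt0 alpha l0.
have xa := powR_gt0 alpha x0.
move: (x `^ alpha) (T `^ alpha) (freq i `^ alpha) (2 `^ alpha) xa Ta la.
move=> xa Ta la ta xa0 Ta0 la0 e h.
have -> : ta / rho alpha / Ta * la^-1 = (rho alpha)^-1 / xa.
  have -> : ta = Ta * la / xa by rewrite -e mulrAC mulfV ?gt_eqF// mul1r.
  by field; rewrite !gt_eqF.
rewrite exprVn ler_pdivrMr ?exprn_gt0// -(ler_pM2l r0).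
rewrite (_ : rho alpha * ((rho alpha)^-1 / xa * x ^+ 2) = x ^+ 2 / xa)//.
by field; rewrite !gt_eqF.
Qed.

(** Every x > 0 has the form T l / 2, with l = 2 x / T, so a common bound M for all
    atoms turns 2^alpha T^(-alpha) / M^2 into a lower bound of the ratios whose
    infimum is rho. *)
Lemma sharp_bound_le (T M : R) : 0 < T ->
  (forall i, `|sin (T * freq i / 2)| / (T * freq i / 2) <= M * power_weight i) ->
  sharp_bound T <= M.
Proof.
move=> T0 hM.
have hM' x : 0 < x -> sin x ^+ 2 / x ^+ 2 * (2 `^ alpha * x `^ alpha / T `^ alpha)
    <= M ^+ 2.
  move=> x0; have l0 : 0 < 2 * x / T by rewrite divr_gt0// mulr_gt0.
  pose i : frequency := exist (fun y : R => is_true (0 < y)) _ l0.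
  have xE : T * freq i / 2 = x.
    by rewrite /freq /= mulrC mulrA mulrC; field; rewrite gt_eqF.
  have := hM i; rewrite xE => h.
  have /ltW h0 : 0 < power_weight i := power_weight_gt0 i.
  have hs : 0 <= `|sin x| / x by rewrite divr_ge0// ltW.
  have : (`|sin x| / x) ^+ 2 <= (M * power_weight i) ^+ 2.
    by rewrite ler_sqr// nnegrE// (le_trans hs).
  rewrite !exprMn real_normK ?num_real// exprVn sqr_power_weight.
  rewrite ler_pdivlMr ?powR_gt0//.
  have := half_period T0 l0; rewrite -[2 * x / T]/(freq i) xE => hp.
  suff -> : 2 `^ alpha * x `^ alpha / T `^ alpha = freq i `^ alpha by [].
  by rewrite [2 `^ _ * _]mulrC hp mulrAC mulfV ?mul1r// gt_eqF ?powR_gt0.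
have M0 : 0 <= M.
  pose i : frequency := exist (fun y : R => is_true (0 < y)) 1 ltr01.
  have := hM i; rewrite -ler_pdivrMr ?power_weight_gt0//; apply: le_trans.
  apply: divr_ge0; last by rewrite ltW// power_weight_gt0.
  by apply: divr_ge0 => //; rewrite ltW// divr_gt0// mulr_gt0// freq_gt0.
have r0 : 0 < rho alpha by rewrite (lt_le_trans ltr01)// rho_ge1.
have Ta := powR_gt0 alpha T0.
have ta : 0 < 2 `^ alpha :> R by rewrite powR_gt0.
rewrite -ler_sqr ?nnegrE ?sqrtr_ge0// sqr_sharp_bound//.
have M2 : 0 < M ^+ 2.
  have p0 : 0 < pi / 2 :> R by rewrite divr_gt0 ?pi_gt0.
  apply: lt_le_trans (hM' _ p0); rewrite sin_pihalf expr1n.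
  by rewrite !(mulr_gt0, invr_gt0, exprn_gt0, powR_gt0, pi_gt0).
suff : 2 `^ alpha / T `^ alpha / M ^+ 2 <= rho alpha.
  rewrite !ler_pdivrMr// => /le_trans; apply.
  by rewrite (_ : M ^+ 2 * T `^ alpha * rho alpha
    = rho alpha * M ^+ 2 * T `^ alpha)//; ring.
apply: rho_greatest => x x0; rewrite powR2B//.
have xa := powR_gt0 alpha x0; have x2 : 0 < x ^+ 2 by rewrite exprn_gt0.
rewrite ler_pdivlMr// -(ler_pM2r M2) -(ler_pM2l (_ : 0 < (x ^+ 2)^-1)) ?invr_gt0//.
rewrite mulKf ?gt_eqF//; apply: le_trans (hM' x x0).
move: (x `^ alpha) (T `^ alpha) xa Ta (x ^+ 2) (M ^+ 2) x2 M2.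
move=> xa Ta xa0 Ta0 q m q0 m0.
rewrite le_eqVlt; apply/orP; left; apply/eqP; field.
by rewrite !gt_eqF.
Qed.

End power_weight.

(** * The example *)

Section sharp_example.
Variables (R : realType) (alpha : R).
Hypothesis halpha : 0 <= alpha <= 2.
Local Notation H := (ell2 R (frequency R)).
Local Notation U := (diag_group (@freq R)).
Local Notation w := (power_weight alpha).

Let w_gt0 := power_weight_gt0 alpha.

(** At time pi / l the coordinate of frequency l changes sign. *)
Lemma diag_group_fixed (f : H) : (forall t, U t f = f) -> f = 0.
Proof.
move=> Uf; apply: ell2P => i; have l0 := freq_gt0 i.
have := congr1 (fun g : H => g i) (Uf (pi / freq i)).
rewrite diag_groupE divfK ?gt_eqF// /expi cospi sinpi => /eqP.
rewrite (_ : (-1) +i* 0 = -1 :> R[i]); last first.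
  by apply/eqP; rewrite eq_complex /= oppr0 !eqxx.
by rewrite mulN1r eq_sym -subr_eq0 opprK -mulr2n mulrn_eq0 /= => /eqP.
Qed.

Lemma diag_projection0 :
  orthogonal_projection (fixed_vectors U) (\0 : {linear H -> H}).
Proof.
move=> f; split=> [t|g /diag_group_fixed ->]; first exact: linear0.
exact: linear0r.
Qed.

(** The upper bound holds coordinatewise; the unit vectors give the lower bound. *)
Lemma diag_operator_norm t s : s < t ->
  operator_norm (weighted_ell2 w) (weighted_norm w)
    (fun f => time_average U t s f - (\0 : {linear H -> H}) f)
  = (sharp_bound alpha (t - s))%:E.
Proof.
move=> st; have T0 : 0 < t - s by rewrite subr_gt0.
have K0 : 0 <= sharp_bound alpha (t - s) by exact: sqrtr_ge0.
have avgE (f : H) : time_average U t s f - (\0 : {linear H -> H}) f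
    = multiplier (avg_factor_contractive (@freq_gt0 R) st) f.
  by rewrite (diag_time_average (@freq_gt0 R) st) subr0.
have [_ w0 w_eq0 _ _] := weighted_norm_subspace w_gt0.
apply/eqP; rewrite eq_le; apply/andP; split.
  apply: ge_ereal_sup => _ [f [fX f0] <-]; rewrite lee_fin avgE.
  have Nf : 0 < weighted_norm w f.
    rewrite lt_def w0// andbT; apply: contra f0 => /eqP /(w_eq0 _ fX) ->.
    by rewrite eqxx.
  rewrite ler_pdivrMr//; apply: hnorm_multiplier_weighted => // i.
  rewrite normc_avg_factor ?freq_gt0//; exact: sinc_le_sharp_bound.
have ub i : ((`|sin ((t - s) * freq i / 2)| / ((t - s) * freq i / 2) / w i)%:E
    <= operator_norm (weighted_ell2 w) (weighted_norm w)
         (fun f => (time_average U t s f - (\0 : {linear H -> H}) f)%R))%E.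
  have [dX dN] := weighted_delta w_gt0 i.
  apply: ereal_sup_ubound; exists (delta R i); first by split=> //; exact: delta_neq0.
  rewrite avgE multiplier_delta hnormZ hnorm_delta mulr1 dN.
  by rewrite normc_avg_factor ?freq_gt0.
move: ub; case: operator_norm => [M|_|].
- move=> ub; rewrite lee_fin; apply: (sharp_bound_le halpha) => // i.
  by rewrite -ler_pdivrMr//; have := ub i; rewrite lee_fin.
- exact: leey.
- by move=> /(_ (exist (fun y : R => is_true (0 < y)) 1 ltr01)).
Qed.

(** The interval is closed on the right, so it contains the atom at freq i. *)
Lemma delta_spectral_measure i :
  spectral_measure (diag_spectral (@freq R)) (delta R i : H)
    `](- freq i), (freq i)]%classic = 1%E.
Proof.
have l0 := freq_gt0 i.
rewrite spectral_measure_itvoc ?ge0_cp ?(ltW l0)// !spectral_distributionE.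
rewrite !diag_spectralE /diag_proj /= !multiplier_delta !hnormZ hnorm_delta !mulr1.
rewrite !normc_nat lexx leNgt (lt_trans _ l0) ?oppr_lt0//.
by rewrite expr1n expr0n subr0.
Qed.

End sharp_example.

Local Close Scope complex_scope.

Theorem mainTheorem8 (R : realType) (alpha : R) (halpha : 0 <= alpha <= 2) :
  exists (H : hilbertType R) (U : R -> {linear H -> H})
    (E : spectral_family H) (P : {linear H -> H})
    (X : {pred H}) (normX : H -> R) (B : R),
    [/\ unitary_group U,
        spectral_resolution U E,
        orthogonal_projection (fixed_vectors U) P,
        subspace_norm X normX &
        0 < B] /\
    (forall t s : R, s < t ->
       (operator_norm X normX (fun f => (time_average U t s f - P f)%R) ^+ 2)%E
         = (B * (t - s) `^ (- alpha))%:E) /\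
    (forall eps : R, 0 < eps < 1 ->
       exists f : H, f \in X /\ exists delta : R, 0 < delta /\
         (((eps * (rho alpha / 2 `^ alpha) * B * normX f ^+ 2
             * delta `^ alpha)%R)%:E
            < spectral_measure E (f - P f)%R `](- delta)%R, delta]%classic)%E).
Proof.
exists (ell2 R (frequency R)), (diag_group (@freq R)), (diag_spectral (@freq R)).
exists (\0 : {linear _ -> _}), (weighted_ell2 (power_weight alpha)).
exists (weighted_norm (power_weight alpha)), (sharp_const alpha).
have w0 := power_weight_gt0 alpha.
split; first split.
- exact: diag_group_unitary.
- exact: diag_spectral_resolution.
- exact: diag_projection0.
- exact: weighted_norm_subspace.
- exact: sharp_const_gt0.
split=> [t s st|eps /andP[eps0 eps1]].
  rewrite diag_operator_norm// -EFin_expe sqr_sqrtr//.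
  by rewrite mulr_ge0 ?powR_ge0// ltW// sharp_const_gt0.
(* The frequency 1; every frequency would do. *)
pose i : frequency R := exist (fun y : R => is_true (0 < y)) 1 ltr01.
have [dX dN] := weighted_delta w0 i.
exists (delta R i); split=> //; exists (freq i); split; first exact: freq_gt0.
rewrite subr0 delta_spectral_measure lte_fin dN sqr_power_weight.
have r0 : 0 < rho alpha by rewrite (lt_le_trans ltr01)// rho_ge1.
rewrite -!mulrA mulVf ?gt_eqF ?powR_gt0 ?freq_gt0// mulr1 /sharp_const.
by rewrite [rho _ * _](_ : _ = 1) ?mulr1//; field; rewrite !gt_eqF ?powR_gt0.
Qed.
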